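(* Let $\mathbb K$ be an algebraically closed field of characteristic $2$, and let $\mathfrak g=\mathfrak o_{\rm gen}(2n)$ be the Lie algebra of matrices $\begin{pmatrix}A&B\\C&A^{\rm t}\end{pmatrix}$ with $A,B,C\in\mathfrak{gl}(n)$, $B=B^{\rm t}$, $C=C^{\rm t}$. Let $a_{ij}=E_{i,j}+E_{n+j,n+i}$ $(1\le i,j\le n)$, $b_{ii}=E_{i,n+i}$, $c_{ii}=E_{n+i,i}$, and $b_{ij}=b_{ji}=E_{i,n+j}+E_{j,n+i}$, $c_{ij}=c_{ji}=E_{n+i,j}+E_{n+j,i}$ for $i\neq j$. (a) For a basis of $H^2(\mathfrak g)$ one can take the classes of the following cocycles: - $\widehat c_{ii}\wedge\widehat c_{jj}$ and $\widehat b_{ii}\wedge\widehat b_{jj}$ for $1\le i<j\le n$; - $\widehat a_{jj}\wedge\widehat c_{jj}+\sum_{i\neq j}\widehat a_{ij}\wedge\widehat c_{ij}$ and $\widehat a_{jj}\wedge\widehat b_{jj}+\sum_{i\ne j}\widehat a_{ji}\wedge\widehat b_{ij}$ for $1\le j\le n$; - $\widehat b_{ii}\wedge\widehat c_{jj}$ for $1\le i,j\le n$, except $i=j=n$. (b) For any $n>2$, for a basis of $H^1(\mathfrak g;\mathfrak g)$ one can take the classes of the derivation $X\mapsto[D_n,X]$, where $D_n=\operatorname{diag}(0_n,1_n)$, and of the derivations $1_{2n}\otimes\widehat c_{jj}$ and $1_{2n}\otimes\widehat b_{jj}$ for $1\le j\le n$.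
   Context: The elements $a_{ij}$ $(1\le i,j\le n)$, $b_{ij},c_{ij}$ $(1\le i\le j\le n)$ form a basis of $\mathfrak g$; hats denote the dual basis; $1_{2n}\otimes\widehat w$ is the linear map $X\mapsto\widehat w(X)1_{2n}$. $H^1(\mathfrak g;\mathfrak g)$ is the space of derivations modulo inner ones and $H^2(\mathfrak g)$ is Chevalley--Eilenberg cohomology with trivial coefficients (alternating forms). *)

(* Defs.v *)
From HB Require Import structures.
From mathcomp Require Import all_boot all_order all_algebra.
From mathcomp Require Import ring.

Set Implicit Arguments.
Unset Strict Implicit.
Unset Printing Implicit Defensive.

Import GRing.Theory.
Local Open Scope ring_scope.

HB.mixin Record Lmodule_isLie (R : nzRingType) L of GRing.Lmodule R L := {
  lie : L -> L -> L;
  lie_linearl : forall y, linear (lie^~ y);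
  lie_linearr : forall x, linear (lie x);
  liexx : forall x, lie x x = 0;
  lie_jacobi : forall x y z,
    lie x (lie y z) + lie y (lie z x) + lie z (lie x y) = 0
}.

#[short(type="vectLieType")]
HB.structure Definition VectLie (R : nzRingType) :=
  { L of Vector R L & Lmodule_isLie R L }.

(* [quotient_basis Z B v]: for subspaces B <= Z of V, the classes modulo B of
   the vectors v k lie in Z / B, span it, and are linearly independent in it *)
Definition quotient_basis (K : fieldType) (V : lmodType K) (Z B : V -> Prop)
    (I : finType) (v : I -> V) : Prop :=
  [/\ forall k, Z (v k),
      forall z, Z z -> exists c : I -> K, B (z - \sum_k c k *: v k)
    & forall c : I -> K, B (\sum_k c k *: v k) -> forall k, c k = 0].

Section Cohomology.
Variables (K : fieldType) (L : vectLieType K).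

Local Notation form1 := 'Hom(L, K^o).
Local Notation form2 := 'Hom(L, 'Hom(L, K^o)).

Implicit Types (l w : form1) (f : form2) (D : 'End(L)).

Lemma lieDl (x y z : L) : lie (x + y) z = lie x z + lie y z.
Proof. by have := lie_linearl z 1 x y; rewrite !scale1r. Qed.

Lemma lieDr (x y z : L) : lie x (y + z) = lie x y + lie x z.
Proof. by have := lie_linearr x 1 y z; rewrite !scale1r. Qed.

Lemma lieC (x y : L) : lie x y = - lie y x.
Proof.
apply/eqP; rewrite -addr_eq0; apply/eqP.
by have := liexx (x + y); rewrite lieDl !lieDr !liexx add0r addr0.
Qed.

Lemma lieNr (x y : L) : lie x (- y) = - lie x y.
Proof.
apply/eqP; rewrite -addr_eq0 -lieDr addNr.
have /eqP := lieDr x 0 0.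
by rewrite addr0 -subr_eq0 opprD addNKr oppr_eq0.
Qed.

(* the Chevalley--Eilenberg differentials with trivial coefficients *)
Definition ce_d1 l (x y : L) : K := - l (lie x y).

Definition ce_d2 f (x y z : L) : K :=
  - f (lie x y) z + f (lie x z) y - f (lie y z) x.

(* in characteristic 2, alternating is stronger than skew-symmetric *)
Definition alternating f : Prop := forall x, f x x = 0.

Definition cocycle2 f : Prop :=
  alternating f /\ (forall x y z, ce_d2 f x y z = 0).

Definition coboundary2 f : Prop := exists l, forall x y, f x y = ce_d1 l x y.

Lemma coboundary2_cocycle f : coboundary2 f -> cocycle2 f.
Proof.
case=> l fE; split=> [x|x y z]; first by rewrite fE /ce_d1 liexx linear0 oppr0.
rewrite /ce_d2 !fE /ce_d1 !opprK (lieC (lie x y) z) (lieC (lie x z) y).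
rewrite (lieC (lie y z) x) (lieC x z) lieNr opprK !linearN /= -!opprD -!linearD.
by rewrite addrC [X in _ + X]addrC addrA lie_jacobi linear0 oppr0.
Qed.

Definition H2_basis (I : finType) (v : I -> form2) : Prop :=
  quotient_basis cocycle2 coboundary2 v.

Definition derivation D : Prop :=
  forall x y, D (lie x y) = lie (D x) y + lie x (D y).

Definition inner D : Prop := exists x, forall y, D y = lie x y.

Lemma inner_derivation D : inner D -> derivation D.
Proof.
case=> u DE x y; rewrite !DE.
have := lie_jacobi u x y.
rewrite (lieC y u) lieNr (lieC y) => /eqP.
by rewrite -addrA -opprD subr_eq0 addrC => /eqP.
Qed.

Definition H1_adjoint_basis (I : finType) (v : I -> 'End(L)) : Prop :=
  quotient_basis derivation inner v.

Definition wedge_fun l w (x : L) : 'Hom(L, K^o) := l x *: w - w x *: l.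

Fact wedge_fun_linear l w : linear (wedge_fun l w).
Proof.
move=> a x y; apply/lfunP=> z.
rewrite /wedge_fun !(add_lfunE, opp_lfunE, scale_lfunE) !linearP /=.
by rewrite /GRing.scale /=; ring.
Qed.

HB.instance Definition _ l w := GRing.isLinear.Build K L 'Hom(L, K^o) *:%R
  (wedge_fun l w) (wedge_fun_linear l w).

Definition wedge l w : form2 := linfun (wedge_fun l w).

Lemma wedgeE l w x y : wedge l w x y = l x * w y - w x * l y.
Proof. by rewrite lfunE /= /wedge_fun add_lfunE opp_lfunE !scale_lfunE. Qed.

Definition tensor_fun (v : L) w (x : L) : L := (w x : K) *: v.

Fact tensor_fun_linear v w : linear (tensor_fun v w).
Proof.
by move=> a x y; rewrite /tensor_fun linearP /= scalerDl scalerA.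
Qed.

HB.instance Definition _ v w := GRing.isLinear.Build K L L *:%R
  (tensor_fun v w) (tensor_fun_linear v w).

(* v (x) w : X |-> w(X) v *)
Definition tensor (v : L) w : 'End(L) := linfun (tensor_fun v w).

Lemma tensorE v w x : tensor v w x = (w x : K) *: v.
Proof. by rewrite lfunE. Qed.

End Cohomology.

Section Commutator.
Variables (K : fieldType) (m : nat).
Implicit Types X Y Z : 'M[K]_m.

Definition mxcomm X Y := X *m Y - Y *m X.

Lemma mxcomm_linearr X : linear (mxcomm X).
Proof.
move=> a Y Z; rewrite /mxcomm mulmxDr mulmxDl -scalemxAr -scalemxAl.
by rewrite scalerBr opprD addrACA.
Qed.

Lemma mxcommC X Y : mxcomm X Y = - mxcomm Y X.
Proof. by rewrite /mxcomm opprB. Qed.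

Lemma mxcomm_linearl Y : linear (mxcomm^~ Y).
Proof.
move=> a X Z; rewrite /= 3!(mxcommC _ Y) mxcomm_linearr.
by rewrite opprD scalerN.
Qed.

Lemma mxcomm_jacobi X Y Z :
  mxcomm X (mxcomm Y Z) + mxcomm Y (mxcomm Z X) + mxcomm Z (mxcomm X Y) = 0.
Proof.
rewrite /mxcomm !mulmxBr !mulmxBl !mulmxA.
set xyz := X *m Y *m Z; set xzy := X *m Z *m Y; set yxz := Y *m X *m Z.
set yzx := Y *m Z *m X; set zxy := Z *m X *m Y; set zyx := Z *m Y *m X.
by apply/matrixP=> i j; rewrite !mxE; ring.
Qed.

End Commutator.

Section OgenSpace.
Variables (K : fieldType) (n : nat).
Local Notation M2n := 'M[K]_(n + n).

Definition ogen_defect (X : M2n) : 'M[K]_n * 'M[K]_n * 'M[K]_n :=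
  (drsubmx X - (ulsubmx X)^T, ursubmx X - (ursubmx X)^T,
   dlsubmx X - (dlsubmx X)^T).

Fact ogen_defect_linear : linear ogen_defect.
Proof.
move=> a X Y; congr (_, _, _);
  by apply/matrixP=> i j; rewrite !mxE; ring.
Qed.

HB.instance Definition _ := GRing.isLinear.Build K M2n
  ('M[K]_n * 'M[K]_n * 'M[K]_n)%type *:%R
  ogen_defect ogen_defect_linear.

(* the space of matrices (A B; C A^T) with B, C symmetric; see ogen_spaceP *)
Definition ogen_space : {vspace M2n} := lker (linfun ogen_defect).

Lemma mem_ogen_space X : (X \in ogen_space) =
  [&& drsubmx X == (ulsubmx X)^T, ursubmx X == (ursubmx X)^T
    & dlsubmx X == (dlsubmx X)^T].
Proof.
by rewrite memv_ker lfunE /= -[0 in LHS]/(0, 0, 0) !xpair_eqE !subr_eq0 andbA.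
Qed.

Lemma ogen_spaceP X :
  reflect (exists A B C : 'M[K]_n,
             [/\ B = B^T, C = C^T & X = block_mx A B C A^T])
          (X \in ogen_space).
Proof.
rewrite mem_ogen_space; apply: (iffP and3P) => [[/eqP eD /eqP eB /eqP eC]|].
  exists (ulsubmx X), (ursubmx X), (dlsubmx X); split=> //.
  by rewrite -eD submxK.
case=> A [B [C [eB eC ->]]].
by rewrite block_mxKul block_mxKur block_mxKdl block_mxKdr -eB -eC.
Qed.

End OgenSpace.

(* The space above is closed under commutators only in characteristic 2, hence
   the argument charK of the Lie algebra. *)
Definition ogen (K : fieldType) (charK : 2%N \in [pchar K]) (n : nat) :
  predArgType := subvs_of (ogen_space K n).

Section Ogen.
Variables (K : fieldType) (charK : 2%N \in [pchar K]) (n : nat).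
Local Notation g := (ogen charK n).
Local Notation U := (ogen_space K n).

HB.instance Definition _ := Vector.copy g (subvs_of U).

Definition ogen_mx (X : g) : 'M[K]_(n + n) := vsval X.

Lemma ogen_mx_inj : injective ogen_mx. Proof. exact: val_inj. Qed.

Fact ogen_mx_linear : linear ogen_mx. Proof. exact: linearP. Qed.

HB.instance Definition _ := GRing.isLinear.Build K g 'M[K]_(n + n) *:%R
  ogen_mx ogen_mx_linear.

Lemma opp_mx2 p q (X : 'M[K]_(p, q)) : - X = X.
Proof. by apply/matrixP=> i j; rewrite mxE (oppr_pchar2 charK). Qed.

Lemma mxcomm_ogen X Y : X \in U -> Y \in U -> mxcomm X Y \in U.
Proof.
case/ogen_spaceP=> A [B [C [eB eC ->]]].
case/ogen_spaceP=> A' [B' [C' [eB' eC' ->]]].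
rewrite mem_ogen_space /mxcomm !mulmx_block opp_block_mx add_block_mx.
rewrite block_mxKul block_mxKur block_mxKdl block_mxKdr.
have trD (M N : 'M[K]_n) : (M + N)^T = M^T + N^T by apply: raddfD.
rewrite !opp_mx2 !trD !trmx_mul !trmxK -eB -eC -eB' -eC'.
by apply/and3P; split; apply/eqP/matrixP=> i j; rewrite !mxE; ring.
Qed.

Definition ogen_lie (X Y : g) : g :=
  Subvs (mxcomm_ogen (subvsP X) (subvsP Y)).

Lemma ogen_lieE X Y : ogen_mx (ogen_lie X Y) = mxcomm (ogen_mx X) (ogen_mx Y).
Proof. by []. Qed.

Fact ogen_lie_linearl Y : linear (ogen_lie^~ Y).
Proof.
move=> a X Z; apply: ogen_mx_inj.
by rewrite ogen_mx_linear !ogen_lieE ogen_mx_linear mxcomm_linearl.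
Qed.

Fact ogen_lie_linearr X : linear (ogen_lie X).
Proof.
move=> a Y Z; apply: ogen_mx_inj.
by rewrite ogen_mx_linear !ogen_lieE ogen_mx_linear mxcomm_linearr.
Qed.

Fact ogen_liexx X : ogen_lie X X = 0.
Proof.
by apply: ogen_mx_inj; rewrite (raddf0 ogen_mx) ogen_lieE /mxcomm subrr.
Qed.

Fact ogen_lie_jacobi X Y Z :
  ogen_lie X (ogen_lie Y Z) + ogen_lie Y (ogen_lie Z X)
    + ogen_lie Z (ogen_lie X Y) = 0.
Proof.
apply: ogen_mx_inj.
rewrite (raddf0 ogen_mx) !(raddfD ogen_mx).
exact: (mxcomm_jacobi (ogen_mx X) (ogen_mx Y) (ogen_mx Z)).
Qed.

HB.instance Definition _ := Lmodule_isLie.Build K g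
  ogen_lie_linearl ogen_lie_linearr ogen_liexx ogen_lie_jacobi.

Local Notation up := (lshift n).
Local Notation dn := (@rshift n n).

Fact a_mx_subproof i j :
  delta_mx (up i) (up j) + delta_mx (dn j) (dn i) \in U.
Proof.
rewrite mem_ogen_space; apply/and3P; split; apply/eqP/matrixP=> p q;
  rewrite !mxE !(eq_lshift, eq_rshift, eq_lrshift, eq_rlshift, andbF) /=.
all: by rewrite ?addr0 ?add0r // andbC.
Qed.

Fact b_mx_subproof i j :
  (if i == j then delta_mx (up i) (dn i)
   else delta_mx (up i) (dn j) + delta_mx (up j) (dn i)) \in U.
Proof.
rewrite mem_ogen_space; apply/and3P; split; apply/eqP/matrixP=> p q;
  case: eqP => [->|_];
  rewrite !mxE !(eq_lshift, eq_rshift, eq_lrshift, eq_rlshift, andbF) //=.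
all: by rewrite ![(q == _) && _]andbC // addrC.
Qed.

Fact c_mx_subproof i j :
  (if i == j then delta_mx (dn i) (up i)
   else delta_mx (dn i) (up j) + delta_mx (dn j) (up i)) \in U.
Proof.
rewrite mem_ogen_space; apply/and3P; split; apply/eqP/matrixP=> p q;
  case: eqP => [->|_];
  rewrite !mxE !(eq_lshift, eq_rshift, eq_lrshift, eq_rlshift, andbF) //=.
all: by rewrite ![(q == _) && _]andbC // addrC.
Qed.

Definition a_ i j : g := Subvs (a_mx_subproof i j).
Definition b_ i j : g := Subvs (b_mx_subproof i j).
Definition c_ i j : g := Subvs (c_mx_subproof i j).

Definition entry_fun (p q : 'I_(n + n)) (X : g) : K^o := ogen_mx X p q.

Fact entry_fun_linear p q : linear (entry_fun p q).
Proof. by move=> k X Y; rewrite /entry_fun ogen_mx_linear !mxE. Qed.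

HB.instance Definition _ p q := GRing.isLinear.Build K g K^o *:%R
  (entry_fun p q) (entry_fun_linear p q).

Definition entry p q : 'Hom(g, K^o) := linfun (entry_fun p q).

Lemma entryE p q X : entry p q X = ogen_mx X p q.
Proof. by rewrite lfunE. Qed.

(* The coordinate forms; they are the dual basis of a_, b_, c_ by
   ogen_dual_basis and ogen_decomp. *)
Definition a_hat i j := entry (up i) (up j).
Definition b_hat i j := entry (up i) (dn j).
Definition c_hat i j := entry (dn i) (up j).

Lemma b_hatC i j : b_hat i j = b_hat j i.
Proof.
apply/lfunP=> X; rewrite !entryE.
have /ogen_spaceP[A [B [C [eB _ ->]]]] : ogen_mx X \in U := subvsP X.
by rewrite !block_mxEur {1}eB mxE.
Qed.

Lemma c_hatC i j : c_hat i j = c_hat j i.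
Proof.
apply/lfunP=> X; rewrite !entryE.
have /ogen_spaceP[A [B [C [_ eC ->]]]] : ogen_mx X \in U := subvsP X.
by rewrite !block_mxEdl {1}eC mxE.
Qed.

Definition le_pair := {p : 'I_n * 'I_n | (p.1 <= p.2)%N}.

Definition ogen_basis (k : 'I_n * 'I_n + (le_pair + le_pair)) : g :=
  match k with
  | inl p => a_ p.1 p.2
  | inr (inl p) => b_ (val p).1 (val p).2
  | inr (inr p) => c_ (val p).1 (val p).2
  end.

Definition ogen_dual (k : 'I_n * 'I_n + (le_pair + le_pair)) : 'Hom(g, K^o) :=
  match k with
  | inl p => a_hat p.1 p.2
  | inr (inl p) => b_hat (val p).1 (val p).2
  | inr (inr p) => c_hat (val p).1 (val p).2
  end.

Lemma ogen_dual_basis k l : ogen_dual k (ogen_basis l) = (k == l)%:R.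
Proof.
have swapF (p q : le_pair) : (val q).1 != (val q).2 ->
    ((val p).1 == (val q).2) && ((val p).2 == (val q).1) = false.
  move=> nq; apply/negP=> /andP[/eqP p1 /eqP p2]; case/eqP: nq.
  by apply/val_inj/eqP; rewrite eqn_leq (valP q) -p1 -p2 (valP p).
case: k l => [[i j]|[p|p]] [[r s]|[q|q]]; rewrite /= entryE /ogen_mx /=.
all: try (have := swapF p q; case: eqVneq => [eq12 _|_ /(_ isT) pqF]).
all: try case: ifP => _.
all: rewrite !mxE.
all: rewrite !(eq_lshift, eq_rshift, eq_lrshift, eq_rlshift, andbF, andFb) /=.
all: rewrite ?addr0 ?add0r //.
- by rewrite {2}eq12.
- by rewrite pqF addr0.
- by rewrite {2}eq12.
- by rewrite pqF addr0.
Qed.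

Lemma ogen_decomp X : X = \sum_k (ogen_dual k X : K) *: ogen_basis k.
Proof.
pose Y := X - \sum_k (ogen_dual k X : K) *: ogen_basis k.
have Y0 k : ogen_dual k Y = 0.
  rewrite linearB linear_sum /= (bigD1 k) //= linearZ /= ogen_dual_basis eqxx.
  rewrite big1 ?addr0 => [|l nlk]; last first.
    by rewrite linearZ /= ogen_dual_basis eq_sym (negPf nlk); apply: mulr0.
  by rewrite /GRing.scale /= mulr1 subrr.
apply/eqP; rewrite -subr_eq0 -/Y; apply/eqP/ogen_mx_inj.
rewrite (raddf0 ogen_mx).
have /ogen_spaceP[A [B [C [eB eC eY]]]] : ogen_mx Y \in U := subvsP Y.
have A0 i j : A i j = 0.
  by have := Y0 (inl (i, j)); rewrite /= entryE eY block_mxEul.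
have le0 (D : 'M[K]_n) : D = D^T ->
    (forall i j : 'I_n, (i <= j)%N -> D i j = 0) -> D = 0.
  move=> eD D0; apply/matrixP=> i j; rewrite mxE.
  by case/orP: (leq_total i j) => /D0 // Dji; rewrite eD mxE.
have {}A0 : A = 0 by apply/matrixP=> i j; rewrite A0 mxE.
have B0 : B = 0.
  apply: le0 eB _ => i j lij; have := Y0 (inr (inl (exist _ (i, j) lij))).
  by rewrite /= entryE eY block_mxEur.
have C0 : C = 0.
  apply: le0 eC _ => i j lij; have := Y0 (inr (inr (exist _ (i, j) lij))).
  by rewrite /= entryE eY block_mxEdl.
by rewrite eY A0 B0 C0 trmx0 block_mx0.
Qed.

Definition lt_pair := {p : 'I_n * 'I_n | (p.1 < p.2)%N}.

Definition not_last_pair :=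
  {p : 'I_n * 'I_n | ~~ [&& p.1 == n.-1 :> nat & p.2 == n.-1 :> nat]}.

Definition H2_cocycles
    (k : (lt_pair + lt_pair) + ('I_n + 'I_n) + not_last_pair) :
    'Hom(g, 'Hom(g, K^o)) :=
  match k with
  | inl (inl (inl p)) =>
      wedge (c_hat (val p).1 (val p).1) (c_hat (val p).2 (val p).2)
  | inl (inl (inr p)) =>
      wedge (b_hat (val p).1 (val p).1) (b_hat (val p).2 (val p).2)
  | inl (inr (inl j)) =>
      wedge (a_hat j j) (c_hat j j)
        + \sum_(i | i != j) wedge (a_hat i j) (c_hat i j)
  | inl (inr (inr j)) =>
      wedge (a_hat j j) (b_hat j j)
        + \sum_(i | i != j) wedge (a_hat j i) (b_hat i j)
  | inr p => wedge (b_hat (val p).1 (val p).1) (c_hat (val p).2 (val p).2)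
  end.

Fact one_subproof : 1%:M \in U.
Proof.
rewrite mem_ogen_space scalar_mx_block.
rewrite block_mxKul block_mxKur block_mxKdl block_mxKdr.
by rewrite tr_scalar_mx trmx0 !eqxx.
Qed.

Definition ogen_one : g := Subvs one_subproof.

Definition D_mx : 'M[K]_(n + n) := block_mx 0 0 0 1%:M.

Fact ad_D_subproof (X : g) : mxcomm D_mx (ogen_mx X) \in U.
Proof.
have /ogen_spaceP[A [B [C [eB eC ->]]]] : ogen_mx X \in U := subvsP X.
apply/ogen_spaceP; exists 0, B, C; split=> //.
rewrite /mxcomm /D_mx !mulmx_block opp_block_mx add_block_mx.
rewrite !(mul0mx, mulmx0, mul1mx, mulmx1, addr0, add0r, subr0, subrr, trmx0).
by rewrite opp_mx2.
Qed.

(* D_mx is not in ogen, hence [D_mx, X] is a commutator in gl(2n). *)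
Definition ad_D_fun (X : g) : g := Subvs (ad_D_subproof X).

Fact ad_D_fun_linear : linear ad_D_fun.
Proof.
move=> a X Y; apply: ogen_mx_inj; rewrite ogen_mx_linear.
by rewrite -mxcomm_linearr -ogen_mx_linear.
Qed.

HB.instance Definition _ := GRing.isLinear.Build K g g *:%R
  ad_D_fun ad_D_fun_linear.

Definition ad_D : 'End(g) := linfun ad_D_fun.

Lemma ad_DE X : ogen_mx (ad_D X) = mxcomm D_mx (ogen_mx X).
Proof. by rewrite lfunE. Qed.

Definition H1_derivations (k : unit + ('I_n + 'I_n)) : 'End(g) :=
  match k with
  | inl _ => ad_D
  | inr (inl j) => tensor ogen_one (c_hat j j)
  | inr (inr j) => tensor ogen_one (b_hat j j)
  end.

End Ogen.

Arguments ogen_one {K} charK n.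
Arguments ad_D {K} charK n.
Arguments H2_cocycles {K} charK n k.
Arguments H1_derivations {K} charK n k.

(* Main.v *)
(* Multiplying by J = (0 1; 1 0) identifies the Lie algebra with the symmetric
   matrices of size 2n, with bracket S J T + T J S; all brackets have zero
   diagonal. The index set carries the involution i <-> n + i, called star, and
   the unit symmetric matrices u_pq (p != q) and d_p = E_pp form a basis. The
   elements h_p = u_{p,star p} span a torus; u_pq has weight [p] + [q] for it
   and d_p has weight 0. The diagonal products d_p^ /\ d_q^ and the forms
   (S J T)_pp are the cocycles of (a). A cocycle, or a derivation, can be made
   torus invariant by subtracting a coboundary, or an inner derivation; its
   remaining weight-zero coordinates are determined by the cocycle identity,
   resp. the Leibniz rule, on a few triples, resp. pairs, of basis elements.
   Classes are detected by explicit functionals that are dual to the given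
   families and vanish on coboundaries. *)

From HB Require Import structures.
Require Import Defs.
From mathcomp Require Import all_boot all_order all_algebra.
From mathcomp Require Import ring.

Set Implicit Arguments.
Unset Strict Implicit.
Unset Printing Implicit Defensive.

Import GRing.Theory.
Local Open Scope ring_scope.

(** * The involution [star] and its orbits *)

Section Star.
Variable n : nat.
Local Notation up := (lshift n).
Local Notation dn := (@rshift n n).
Implicit Types p q : 'I_(n + n).

Definition star p : 'I_(n + n) :=
  match split p with inl i => dn i | inr i => up i end.

Lemma star_lshift i : star (up i) = dn i.
Proof. by rewrite /star (unsplitK (inl i)). Qed.

Lemma star_rshift i : star (dn i) = up i.
Proof. by rewrite /star (unsplitK (inr i)). Qed.

Lemma starK : involutive star.
Proof.
by move=> p; rewrite -(splitK p); case: (split p) => i;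
  rewrite ?(star_lshift, star_rshift).
Qed.

Lemma star_eq p q : (star p == star q) = (p == q).
Proof. exact: can_eq starK p q. Qed.

Lemma star_neq p : (p == star p) = false.
Proof.
rewrite -(splitK p); case: (split p) => i;
  by rewrite /= ?(star_lshift, star_rshift) (eq_lrshift, eq_rlshift).
Qed.

Lemma eq_starl p q : (star p == q) = (p == star q).
Proof. exact: can2_eq starK starK p q. Qed.

(** Different orbits of [star]: the condition under which [ogen_u p q] is a root vector, rather than
    zero or a torus element. *)
Definition apart p q := (p != q) && (p != star q).

Lemma apartC p q : apart p q = apart q p.
Proof.
by rewrite /apart eq_sym -eq_starl [star p == q]eq_sym.
Qed.

Lemma apart_starl p q : apart (star p) q = apart p q.
Proof.
by rewrite /apart star_eq andbC eq_starl.
Qed.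

Lemma apart_starr p q : apart p (star q) = apart p q.
Proof. by rewrite apartC apart_starl apartC. Qed.

(** Packaged as a tuple of equations, so that a single rewrite settles every Kronecker delta of a
    bracket formula. *)
Lemma apartF p q : apart p q ->
  ((p == q) = false) * ((q == p) = false) *
  ((p == star q) = false) * ((q == star p) = false) *
  ((star p == q) = false) * ((star q == p) = false).
Proof.
move=> pq; have := pq; rewrite apartC in pq => /andP[/negPf-> /negPf pq1].
case/andP: pq => /negPf-> /negPf qp1.
by rewrite pq1 qp1 !(eq_sym (star _)) pq1 qp1.
Qed.

Lemma star_neqr p : (star p == p) = false.
Proof. by rewrite eq_sym star_neq. Qed.

Definition idx p : 'I_n := match split p with inl i => i | inr i => i end.

Lemma idx_lshift i : idx (up i) = i.
Proof. by rewrite /idx (unsplitK (inl i)). Qed.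

Lemma idx_rshift i : idx (dn i) = i.
Proof. by rewrite /idx (unsplitK (inr i)). Qed.

Lemma idx_star p : idx (star p) = idx p.
Proof.
by rewrite -(splitK p); case: (split p) => i;
  rewrite /= ?(star_lshift, star_rshift) ?(idx_lshift, idx_rshift).
Qed.

Lemma apartE p q : apart p q = (idx p != idx q).
Proof.
rewrite /apart -(splitK p) -(splitK q); case: (split p) (split q) => i [] j;
  rewrite /= ?(star_lshift, star_rshift) ?(idx_lshift, idx_rshift)
    ?(eq_lshift, eq_rshift, eq_lrshift, eq_rlshift) ?andbT //.
Qed.

Definition starE := (starK, star_eq, star_neq, star_neqr).

End Star.

(** * Symmetric coordinates and brackets of the unit matrices *)

Section Ogen.
Variables (K : fieldType) (charK : 2%N \in [pchar K]) (n : nat).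
Local Notation g := (ogen charK n).
Local Notation up := (lshift n).
Local Notation dn := (@rshift n n).
Implicit Types (p q r s t : 'I_(n + n)) (X Y Z : g).

(* Writing X = S J with S symmetric and J the permutation matrix of star,
   [scoord X p q] is S p q. *)
Definition scoord X p q : K := ogen_mx X p (star q).

Lemma mem_ogen_star (M : 'M[K]_(n + n)) :
  (forall p q, M p (star q) = M q (star p)) -> M \in ogen_space K n.
Proof.
move=> MC; rewrite mem_ogen_space; apply/and3P; split; apply/eqP/matrixP=> i j;
  rewrite !mxE.
- by have := MC (dn i) (up j); rewrite star_lshift star_rshift.
- by have := MC (up i) (up j); rewrite !star_lshift.
by have := MC (dn i) (dn j); rewrite !star_rshift.
Qed.

Lemma scoordC X p q : scoord X p q = scoord X q p.
Proof.
have : ogen_mx X \in ogen_space K n by exact: subvsP.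
rewrite mem_ogen_space /scoord => /and3P[/eqP/matrixP eD /eqP/matrixP eB].
move=> /eqP/matrixP eC.
rewrite -(splitK p) -(splitK q); case: (split p) (split q) => i [] j /=;
  rewrite ?(star_lshift, star_rshift).
- by have := eB i j; rewrite !mxE.
- by have := eD j i; rewrite !mxE.
- by have := eD i j; rewrite !mxE.
by have := eC i j; rewrite !mxE.
Qed.

Lemma scoord_inj X Y : (forall p q, scoord X p q = scoord Y p q) -> X = Y.
Proof.
move=> XY; apply: ogen_mx_inj; apply/matrixP=> p q.
by have := XY p (star q); rewrite /scoord starK.
Qed.

Lemma scoord_surj (F : 'I_(n + n) -> 'I_(n + n) -> K) :
  (forall p q, F p q = F q p) -> exists X, forall p q, scoord X p q = F p q.
Proof.
move=> FC; have FU : \matrix_(p, q) F p (star q) \in ogen_space K n.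
  by apply: mem_ogen_star => p q; rewrite !mxE !starK.
by exists (Subvs FU) => p q; rewrite /scoord mxE starK.
Qed.

Fact scoord_linear p q : linear (fun X => scoord X p q : K^o).
Proof. by move=> a X Y; rewrite /scoord ogen_mx_linear !mxE. Qed.

Lemma scoordD X Y p q : scoord (X + Y) p q = scoord X p q + scoord Y p q.
Proof. by have := scoord_linear p q 1 X Y; rewrite !scale1r. Qed.

Lemma scoord0 p q : scoord 0 p q = 0.
Proof. by rewrite /scoord (raddf0 (@ogen_mx _ charK n)) mxE. Qed.

Lemma scoordZ a X p q : scoord (a *: X) p q = a * scoord X p q.
Proof. by have := scoord_linear p q a X 0; rewrite !scoord0 !addr0. Qed.

Lemma scoordMb X p q (b : bool) : scoord (X *+ b) p q = scoord X p q *+ b.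
Proof. by case: b; rewrite ?mulr1n ?mulr0n ?scoord0. Qed.

Lemma scoordN X p q : scoord (- X) p q = scoord X p q.
Proof. by rewrite -scaleN1r scoordZ mulN1r (oppr_pchar2 charK). Qed.

Fact ogen_u_subproof p q :
  delta_mx p (star q) + delta_mx q (star p) \in ogen_space K n.
Proof.
apply: mem_ogen_star => r s; rewrite !mxE !starE addrC.
by congr (_ + _); rewrite andbC.
Qed.

Fact ogen_d_subproof p : delta_mx p (star p) \in ogen_space K n.
Proof. by apply: mem_ogen_star => r s; rewrite !mxE !starE andbC. Qed.

(* (E_pq + E_qp) J and E_pp J; in particular [ogen_u p p = 0]. *)
Definition ogen_u p q : g := Subvs (ogen_u_subproof p q).
Definition ogen_d p : g := Subvs (ogen_d_subproof p).

Local Notation u := ogen_u.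
Local Notation d := ogen_d.

Lemma ogen_uC p q : u p q = u q p.
Proof. by apply: val_inj => /=; rewrite addrC. Qed.

Lemma addgg X : X + X = 0.
Proof.
apply: scoord_inj => p q.
by rewrite scoordD scoord0 (addrr_pchar2 charK).
Qed.

Lemma ogen_upp p : u p p = 0.
Proof.
by apply: scoord_inj => r s; rewrite scoord0 /scoord !mxE (addrr_pchar2 charK).
Qed.

Lemma scoord_u p q r s :
  scoord (u p q) r s = ((r == p) && (s == q))%:R + ((r == q) && (s == p))%:R.
Proof. by rewrite /scoord !mxE !starE. Qed.

Lemma scoord_d p r s : scoord (d p) r s = ((r == p) && (s == p))%:R.
Proof. by rewrite /scoord !mxE !starE. Qed.

Lemma lieCg X Y : lie X Y = lie Y X.
Proof.
rewrite lieC; apply: scoord_inj => p q; by rewrite scoordN.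
Qed.

Lemma ogen_mx_lie X Y :
  ogen_mx (lie X Y) = ogen_mx X *m ogen_mx Y + ogen_mx Y *m ogen_mx X.
Proof. by rewrite -[LHS]/(mxcomm _ _) /mxcomm (opp_mx2 charK). Qed.

Lemma ogen_mxMn X k : ogen_mx (X *+ k) = ogen_mx X *+ k.
Proof. exact: raddfMn. Qed.

Lemma lie_uu p q r s :
  lie (u p q) (u r s) = u p s *+ (star q == r) + u p r *+ (star q == s)
                        + u q s *+ (star p == r) + u q r *+ (star p == s).
Proof.
apply: ogen_mx_inj.
rewrite ogen_mx_lie !(raddfD (@ogen_mx _ charK n)) /= !ogen_mxMn.
rewrite /ogen_mx /= !mulmxDl !mulmxDr !mul_delta_mx_cond !mulrnDl.
rewrite !(eq_sym (star r)) !(eq_sym (star s)) -!eq_starl.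
by apply/matrixP=> i j; rewrite !mxE; ring.
Qed.

Lemma lie_du p r s :
  lie (d p) (u r s) = u p s *+ (star p == r) + u p r *+ (star p == s).
Proof.
apply: ogen_mx_inj.
rewrite ogen_mx_lie !(raddfD (@ogen_mx _ charK n)) /= !ogen_mxMn.
rewrite /ogen_mx /= !mulmxDl !mulmxDr !mul_delta_mx_cond !mulrnDl.
rewrite !(eq_sym (star r)) !(eq_sym (star s)) -!eq_starl.
by apply/matrixP=> i j; rewrite !mxE; ring.
Qed.

Lemma lie_dd p r : lie (d p) (d r) = u p r *+ (star p == r).
Proof.
apply: ogen_mx_inj; rewrite ogen_mx_lie !ogen_mxMn.
rewrite /ogen_mx /= !mul_delta_mx_cond !mulrnDl.
rewrite !(eq_sym (star r)) -!eq_starl.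
by apply/matrixP=> i j; rewrite !mxE; ring.
Qed.

Lemma scoord_lie X Y r s :
  scoord (lie X Y) r s = \sum_t (scoord X r t * scoord Y (star t) s)
                       + \sum_t (scoord Y r t * scoord X (star t) s).
Proof.
rewrite /scoord ogen_mx_lie !mxE; congr (_ + _);
  by rewrite (reindex_inj (inv_inj (@starK n))).
Qed.

Lemma scoord_lied p X r s :
  scoord (lie (d p) X) r s = scoord X (star p) s *+ (r == p)
                            + scoord X r (star p) *+ (s == p).
Proof.
rewrite scoord_lie; congr (_ + _).
  rewrite (bigD1 p) //= big1 ?addr0 => [|t /negPf tp].
    by rewrite scoord_d eqxx andbT mulr_natl.
  by rewrite scoord_d tp andbF mul0r.
rewrite (bigD1 (star p)) //= big1 ?addr0 => [|t tp].
  by rewrite scoord_d starK eqxx mulr_natr.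
by rewrite scoord_d eq_starl (negPf tp) mulr0.
Qed.

Lemma scoord_lieu p q X r s :
  scoord (lie (u p q) X) r s = scoord X (star q) s *+ (r == p)
    + scoord X (star p) s *+ (r == q) + scoord X r (star p) *+ (s == q)
    + scoord X r (star q) *+ (s == p).
Proof.
rewrite scoord_lie -addrA; congr (_ + _).
  under eq_bigr do rewrite scoord_u mulrDl.
  rewrite big_split /=; congr (_ + _).
    rewrite (bigD1 q) //= big1 ?addr0 => [|t /negPf tp].
      by rewrite eqxx andbT mulr_natl.
    by rewrite tp andbF mul0r.
  rewrite (bigD1 p) //= big1 ?addr0 => [|t /negPf tp].
    by rewrite eqxx andbT mulr_natl.
  by rewrite tp andbF mul0r.
under eq_bigr do rewrite scoord_u mulrDr.
rewrite big_split /=; congr (_ + _).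
  rewrite (bigD1 (star p)) //= big1 ?addr0 => [|t tp].
    by rewrite starK eqxx mulr_natr.
  by rewrite eq_starl (negPf tp) mulr0.
rewrite (bigD1 (star q)) //= big1 ?addr0 => [|t tp].
  by rewrite starK eqxx mulr_natr.
by rewrite eq_starl (negPf tp) mulr0.
Qed.

Lemma a_E i j : a_ charK i j = u (up i) (dn j).
Proof. by apply: val_inj => /=; rewrite star_lshift star_rshift. Qed.

Lemma b_E i j : b_ charK i j = if i == j then d (up i) else u (up i) (up j).
Proof. by apply: val_inj => /=; case: eqP => _ /=; rewrite !star_lshift. Qed.

Lemma c_E i j : c_ charK i j = if i == j then d (dn i) else u (dn i) (dn j).
Proof. by apply: val_inj => /=; case: eqP => _ /=; rewrite !star_rshift. Qed.

Lemma ogen_ud_ind (P : g -> Prop) :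
  P 0 -> (forall X Y, P X -> P Y -> P (X + Y)) ->
  (forall a X, P X -> P (a *: X)) ->
  (forall p q, P (u p q)) -> (forall p, P (d p)) -> forall X, P X.
Proof.
move=> P0 PD PZ Pu Pd X; rewrite (ogen_decomp X); apply: (big_ind P) => // k _.
apply: PZ; case: k => [[i j]|[[[i j] ?]|[[i j] ?]]] /=;
  rewrite ?a_E ?b_E ?c_E //;
  by case: eqP.
Qed.

Lemma eq_lfun_ud (V : vectType K) (f1 f2 : 'Hom(g, V)) :
  (forall p q, apart p q -> f1 (u p q) = f2 (u p q)) ->
  (forall p, f1 (u p (star p)) = f2 (u p (star p))) ->
  (forall p, f1 (d p) = f2 (d p)) -> f1 = f2.
Proof.
move=> eu eh ed; apply/lfunP=> X; elim/ogen_ud_ind: X => //.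
- by rewrite !linear0.
- by move=> X Y eX eY; rewrite !linearD /= eX eY.
- by move=> a X eX; rewrite !linearZ /= eX.
move=> p q; case: (eqVneq p q) => [->|pq]; first by rewrite ogen_upp !linear0.
case: (eqVneq p (star q)) => [->|psq]; first by rewrite ogen_uC.
by apply: eu; rewrite /apart pq.
Qed.

End Ogen.

(** * Torus action and vanishing of normalized 2-cocycles *)

Section Cocycle.
Variables (K : fieldType) (charK : 2%N \in [pchar K]) (n : nat).
Local Notation g := (ogen charK n).
Local Notation u := (ogen_u charK).
Local Notation d := (ogen_d charK).
Local Notation h p := (u p (star p)).
Local Notation up := (lshift n).
Implicit Types (p q r s t : 'I_(n + n)) (X Y Z : g).

Lemma h_star p : h (star p) = h p.
Proof. by rewrite starK ogen_uC. Qed.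

Lemma not_apart p q : ~~ apart p q -> p = q \/ p = star q.
Proof. by rewrite negb_and !negbK => /orP[]/eqP; [left | right]. Qed.

Lemma h_not_apart p q : ~~ apart p q -> h p = h q.
Proof. by case/not_apart=> ->; rewrite // h_star. Qed.

Definition lie_simp :=
  (mulr0n, mulr1n, addr0, add0r, ogen_upp, lie_uu, lie_du, lie_dd, eqxx, starE).

Lemma lie_hd p q : lie (h p) (d q) = 0.
Proof.
rewrite lieCg lie_du star_eq.
case: eqP => [<-|_]; first by rewrite !starE ogen_upp mul0rn addr0.
by case: eqP => [->|_]; rewrite ?ogen_upp ?mul0rn addr0.
Qed.

Lemma lie_hu p q : apart p q -> lie (h p) (u p q) = u p q.
Proof.
by move=> pq; rewrite lie_uu !(apartF pq, starE) !eqxx ogen_upp !lie_simp.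
Qed.

Lemma lie_hu0 p r s : apart p r -> apart p s -> lie (h p) (u r s) = 0.
Proof.
by move=> pr ps; rewrite lie_uu !(apartF pr, apartF ps, starE) !lie_simp.
Qed.

Lemma lie_hh p q : lie (h p) (h q) = 0.
Proof.
have [pq|/h_not_apart->] := boolP (apart p q); last by rewrite liexx.
by rewrite lie_hu0 // apart_starr.
Qed.

Lemma lie_uu_star p q :
  apart p q -> lie (u p q) (u (star p) (star q)) = h p + h q.
Proof. by move=> pq; rewrite lie_uu !(apartF pq, starE) !lie_simp. Qed.

Lemma lie_dd_star p : lie (d p) (d (star p)) = h p.
Proof. by rewrite !lie_simp. Qed.

Lemma lie_du1 p q : apart p q -> lie (d p) (u (star p) q) = u p q.
Proof. by move=> pq; rewrite lie_du !(apartF pq, starE) !lie_simp. Qed.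

Lemma lie_uu1 p q r : apart p q -> apart p r -> apart q r ->
  lie (u p q) (u (star q) r) = u p r.
Proof.
move=> pq pr qr.
by rewrite lie_uu !(apartF pq, apartF pr, apartF qr, starE) !lie_simp.
Qed.

Section Rigid.
Variable f : 'Hom(g, 'Hom(g, K^o)).
Hypothesis cf : cocycle2 f.
Let F X Y : K := f X Y.

Let FDl X Y Z : F (X + Y) Z = F X Z + F Y Z.
Proof. by rewrite /F linearD /= add_lfunE. Qed.

Let F0l Z : F 0 Z = 0.
Proof. by rewrite /F linear0 zero_lfunE. Qed.

Let F0r Z : F Z 0 = 0.
Proof. by rewrite /F linear0. Qed.

Let Fxx X : F X X = 0.
Proof. by have [altf _] := cf; exact: altf. Qed.

Lemma pchar2_add_eq0 (a b : K) : a + b = 0 -> a = b.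
Proof. by move/eqP; rewrite addr_eq0 (oppr_pchar2 charK) => /eqP. Qed.

Lemma alternatingC X Y : alternating f -> f X Y = f Y X.
Proof.
move=> altf; apply: pchar2_add_eq0; have := altf (X + Y).
by rewrite !linearD /= !add_lfunE !altf add0r addr0 addrC.
Qed.

Let FC X Y : F X Y = F Y X.
Proof. by apply: alternatingC; have [altf _] := cf. Qed.

Lemma cocycle2_pchar2 X Y Z :
  f (lie X Y) Z + f (lie X Z) Y + f (lie Y Z) X = 0 :> K.
Proof.
have [_ /(_ X Y Z)] := cf; rewrite /ce_d2.
rewrite (oppr_pchar2 charK (f (lie X Y) Z)).
by rewrite (oppr_pchar2 charK (f (lie Y Z) X)).
Qed.

Let Fcyc X Y Z : F (lie X Y) Z + F (lie X Z) Y + F (lie Y Z) X = 0.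
Proof. exact: cocycle2_pchar2. Qed.

(** The commuting elements h_r and h_s both fix u_rs, so the cocycle identity on these three
    compares the two values. It makes the correcting linear form of [coboundary_of_H2_functional]
    well defined on u_rs = u_sr. *)
Lemma cocycle2_hu_eq r s : apart r s -> f (h r) (u r s) = f (h s) (u r s).
Proof.
move=> rs; have := Fcyc (h r) (h s) (u r s).
rewrite lie_hh lie_hu // [u r s]ogen_uC lie_hu ?[apart s r]apartC //.
rewrite F0l add0r FC => /pchar2_add_eq0; rewrite (FC (u s r)) /F => <- //.
Qed.

(** The values on root vectors whose bracket lies in the torus. By [GC] and [G_starr] they depend
    only on the two orbits, and by [G_triangle] they are determined by the values at one fixed
    orbit. *)
Let G p q := F (u p q) (u (star p) (star q)).

Let GC p q : G p q = G q p.
Proof. by rewrite /G ogen_uC (ogen_uC _ (star p)). Qed.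

Let G_starr p q : apart p q -> G p (star q) = G p q.
Proof.
move=> pq; have := Fcyc (u p (star q)) (u (star p) (star q)) (d q).
have qp : apart q p by rewrite apartC.
rewrite lie_uu !(apartF pq, starE) !lie_simp F0l add0r.
rewrite !(lieCg _ (d q)) !lie_du !(apartF pq, starE) !lie_simp.
rewrite [u q p]ogen_uC [u q (star p)]ogen_uC (FC (u (star p) q)) /G starK.
by move/pchar2_add_eq0.
Qed.

(** The cocycle identity on three root vectors of weights [p]+[q], [p]+[r], [q]+[r]: each bracket of
    two of them pairs with the third to a value of [G]. *)
Let G_triangle p q r : apart p q -> apart p r -> apart q r ->
  G p q = G p r + G q r.
Proof.
move=> pq pr qr; have := Fcyc (u q p) (u (star p) (star r)) (u (star q) r).
rewrite !lie_uu !(apartF pq, apartF pr, apartF qr, starE) !lie_simp.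
rewrite -(G_starr qr) /G starK [u q p]ogen_uC [F (u (star p) _) _]FC.
by rewrite addrC => /pchar2_add_eq0 ->; rewrite addrC.
Qed.

(** The first hypothesis makes [f] torus invariant, which kills all pairs of different weights.
    Pairs of equal weight are reduced by brackets to the values assumed zero, [p0] being the fixed
    orbit for [G]. *)
Lemma cocycle2_eq0 (p0 : 'I_(n + n)) :
  (forall p q, apart p q -> f (h p) (u p q) = 0) ->
  (forall p, f (h p) (d p) = 0) ->
  (forall p q, f (d p) (d q) = 0) ->
  (forall i, f (u (up i) p0) (u (star (up i)) (star p0)) = 0) ->
  f = 0.
Proof.
move=> f_hu f_hd f_dd f_uu.
have Fhu p r s : apart r s -> F (h p) (u r s) = 0.
  move=> rs; have [pr|/h_not_apart->] := boolP (apart p r); last exact: f_hu.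
  have [ps|/h_not_apart->] := boolP (apart p s); last first.
    by rewrite [u r s]ogen_uC; apply: f_hu; rewrite apartC.
  have := Fcyc (h p) (h r) (u r s).
  by rewrite lie_hh lie_hu0 // lie_hu // !F0l !add0r FC.
have Fdu p r s : apart r s -> F (d p) (u r s) = 0.
  move=> rs; have := Fcyc (h r) (u r s) (d p).
  rewrite lie_hu // lie_hd F0l addr0 FC lieCg lie_du => /pchar2_add_eq0->.
  have [pr|_] := eqVneq (star p) r.
    have := rs; rewrite -pr apart_starl => ps.
    by rewrite (apartF ps) addr0 FC Fhu // h_not_apart // /apart starE.
  rewrite mulr0n add0r; have [ps|_] := eqVneq (star p) s; last exact: F0l.
  by have := rs; rewrite mulr1n -ps apart_starr apartC FC => /Fhu.
(* Here h_r fixes u_rs and kills u_tw, and the bracket of the two is again a combination of root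
   vectors, to which [Fhu] applies. *)
have Fuu0 r s t w : apart r s -> apart t w -> apart r t -> apart r w ->
    F (u r s) (u t w) = 0.
  move=> rs tw rt rw; have := Fcyc (h r) (u r s) (u t w).
  rewrite lie_hu // lie_hu0 // F0l addr0 => /pchar2_add_eq0->.
  rewrite FC lie_uu !(apartF rt, apartF rw) !mulr0n !addr0.
  case: eqP => _; case: eqP => _; rewrite ?mulr0n ?mulr1n ?addr0 ?add0r //;
    rewrite ?[F _ (_ + _)]FC ?FDl ?[F (u _ _) (h _)]FC ?Fhu ?addr0 ?F0r //.
(* Write h_p + h_q as a bracket of opposite root vectors. Both are fixed by h_q, so the other two
   terms of the identity are equal and cancel. *)
have Fhh p q : F (h p) (h q) = 0.
  have [pq|/h_not_apart->] := boolP (apart p q); last exact: Fxx.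
  have := Fcyc (u p q) (u (star p) (star q)) (h q).
  rewrite lie_uu_star // FDl Fxx addr0 !(lieCg _ (h q)).
  rewrite [u p q]ogen_uC lie_hu; last by rewrite apartC.
  rewrite -(h_star q) [u (star p) _]ogen_uC.
  rewrite lie_hu ?apart_starl ?apart_starr 1?apartC //.
  by rewrite h_star -addrA [X in _ + (_ + X)]FC (addrr_pchar2 charK) addr0.
have Fhd p q : F (h p) (d q) = 0.
  have [pq|/h_not_apart->] := boolP (apart p q); last exact: f_hd.
  have := Fcyc (d p) (d (star p)) (d q).
  by rewrite !lie_dd !(apartF pq, starE) !lie_simp !F0l !addr0.
(* In the identity with d_p, the bracket of the two root vectors lies in the torus, where [Fhd]
   applies; d_p kills one root vector and moves the other to the wanted one. *)
have Fuu1 p q : apart p q -> F (u (star q) p) (u q p) = 0.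
  move=> pq; have := Fcyc (u q p) (u (star q) (star p)) (d p).
  rewrite lie_uu_star 1?apartC // FDl !Fhd !add0r !(lieCg _ (d p)).
  rewrite !lie_du !(apartF pq, starE) !lie_simp F0l add0r.
  by rewrite [u p (star q)]ogen_uC.
(* The hypothesis gives [G r p0] for r in the upper half, [G_starr] extends it to all r, and
   [G_triangle] through [p0] reaches the other pairs. *)
have G0 p q : apart p q -> G p q = 0.
  have Gp0 i : apart (up i) p0 -> G (up i) p0 = 0 by move=> _; apply: f_uu.
  have {}Gp0 r : apart r p0 -> G r p0 = 0.
    rewrite -(splitK r); case: (split r) => i /=; first exact: Gp0.
    rewrite -star_lshift apart_starl => rp; have pr := rp; rewrite apartC in pr.
    by rewrite GC G_starr // GC; apply: Gp0.
  move=> pq; have [pp0|] := boolP (apart p p0); last first.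
    case/not_apart=> def_p; rewrite def_p in pq *; rewrite GC.
      by apply: Gp0; rewrite apartC.
    by rewrite G_starr ?Gp0 // -?[apart q p0]apart_starr apartC.
  have [qp0|] := boolP (apart q p0); last first.
    case/not_apart=> def_q; rewrite def_q in pq *; first exact: Gp0.
    by rewrite G_starr ?Gp0.
  by rewrite (G_triangle pq pp0 qp0) !Gp0 ?addr0.
have Fuu2 p q r s : apart p q -> apart r s -> ~~ apart p r ->
    F (u p q) (u r s) = 0.
  move=> pq rs pr; have qp : apart q p by rewrite apartC.
  have qr : apart q r.
    by case/not_apart: pr qp => ->; rewrite ?apart_starr.
  have [qs|nqs] := boolP (apart q s); first by rewrite ogen_uC Fuu0.
  rewrite apartC in nqs.
  case/not_apart: nqs {rs} => ->; rewrite apartC in pr;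
    case/not_apart: pr => ->.
  - exact: Fxx.
  - by rewrite FC Fuu1.
  - by rewrite [u p q]ogen_uC [u p _]ogen_uC FC Fuu1.
  exact: G0.
have Fuu p q r s : apart p q -> apart r s -> F (u p q) (u r s) = 0.
  move=> pq rs; have [pr|] := boolP (apart p r); last exact: Fuu2.
  have [ps|nps] := boolP (apart p s); first exact: Fuu0.
  by rewrite [u r s]ogen_uC Fuu2 // apartC.
apply: eq_lfun_ud => [p q pq|p|p]; rewrite zero_lfunE; apply: eq_lfun_ud.
all: move=> *; rewrite zero_lfunE.
- exact: Fuu.
- by rewrite -/(F _ _) FC Fhu.
- by rewrite -/(F _ _) FC Fdu.
- exact: Fhu.
- exact: Fhh.
- exact: Fhd.
- exact: Fdu.
- by rewrite -/(F _ _) FC Fhd.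
exact: f_dd.
Qed.

End Rigid.
End Cocycle.

(** * Bases of quotients from dual functionals; linear structure on cocycles and derivations *)

Lemma quotient_basis_dual (K : fieldType) (V : lmodType K) (Z B : V -> Prop)
    (I : finType) (v : I -> V) (phi : I -> V -> K) :
  (forall k, Z (v k)) ->
  (forall a x y, Z x -> Z y -> Z (a *: x + y)) ->
  (forall k a x y, phi k (a *: x + y) = a * phi k x + phi k y) ->
  (forall k l, phi k (v l) = (k == l)%:R) ->
  (forall k x, B x -> phi k x = 0) ->
  (forall z, Z z -> (forall k, phi k z = 0) -> B z) ->
  quotient_basis Z B v.
Proof.
move=> Zv Zlin phi_lin phi_v phiB B_phi.
have phiD k x y : phi k (x + y) = phi k x + phi k y.
  by have := phi_lin k 1 x y; rewrite scale1r mul1r.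
have phi0 k : phi k 0 = 0.
  by apply: (addrI (phi k 0)); rewrite -phiD !addr0.
have phiZ k a x : phi k (a *: x) = a * phi k x.
  by have := phi_lin k a x 0; rewrite phi0 !addr0.
have phi_sum k (c : I -> K) : phi k (\sum_l c l *: v l) = c k.
  rewrite (big_morph (phi k) (phiD k) (phi0 k)) (bigD1 k) //= big1 => [|l nlk].
    by rewrite phiZ phi_v eqxx mulr1 addr0.
  by rewrite phiZ phi_v eq_sym (negPf nlk) mulr0.
split=> // [z Zz|c Bc k]; last by rewrite -(phi_sum k c) phiB.
(* With the functionals themselves as coefficients, the remainder stays in [Z] and is killed by
   every [phi k]. *)
exists (phi^~ z); apply: B_phi => [|k].
  have Zsum (c : I -> K) : Z (z + \sum_k c k *: v k).
    elim: (index_enum I) => [|k r IHr]; first by rewrite big_nil addr0.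
    by rewrite big_cons addrCA; apply: Zlin.
  have := Zsum (fun k => - phi k z); congr (Z _); congr (_ + _).
  by rewrite -sumrN; apply: eq_bigr => k _; rewrite scaleNr.
by rewrite phiD -scaleN1r phiZ phi_sum mulN1r subrr.
Qed.

Section Inner.
Variables (K : fieldType) (L : vectLieType K).
Implicit Types (x y : L) (l : 'Hom(L, K^o)).

HB.instance Definition _ x := GRing.isLinear.Build K L L *:%R
  (lie x) (lie_linearr x).

Definition ad x : 'End(L) := linfun (lie x).

Lemma adE x y : ad x y = lie x y.
Proof. by rewrite lfunE. Qed.

Definition lie_form_fun l x : 'Hom(L, K^o) := (l \o ad x)%VF.

Fact lie_form_fun_linear l : linear (lie_form_fun l).
Proof.
move=> a x y; apply/lfunP=> z.
by rewrite add_lfunE scale_lfunE !comp_lfunE !adE lie_linearl linearP.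
Qed.

HB.instance Definition _ l := GRing.isLinear.Build K L 'Hom(L, K^o) *:%R
  (lie_form_fun l) (lie_form_fun_linear l).

Definition lie_form l : 'Hom(L, 'Hom(L, K^o)) := linfun (lie_form_fun l).

Lemma lie_formE l x y : lie_form l x y = l (lie x y).
Proof. by rewrite lfunE /= comp_lfunE adE. Qed.

Lemma coboundary2_lie_form l : coboundary2 (lie_form l).
Proof.
exists (- l) => x y.
by rewrite lie_formE /ce_d1 opp_lfunE opprK.
Qed.

Lemma cocycle2_lin a (f1 f2 : 'Hom(L, 'Hom(L, K^o))) :
  cocycle2 f1 -> cocycle2 f2 -> cocycle2 (a *: f1 + f2).
Proof.
case=> alt1 cyc1 [alt2 cyc2]; split=> [x|x y z].
  by rewrite !add_lfunE !scale_lfunE alt1 alt2 scaler0 addr0.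
have := congr2 (fun b c => a * b + c) (cyc1 x y z) (cyc2 x y z).
rewrite mulr0 addr0 /ce_d2 !add_lfunE !scale_lfunE => <-.
by rewrite /GRing.scale /=; ring.
Qed.

Lemma derivation_lin a (D1 D2 : 'End(L)) :
  derivation D1 -> derivation D2 -> derivation (a *: D1 + D2).
Proof.
move=> der1 der2 x y; rewrite !add_lfunE !scale_lfunE der1 der2.
by rewrite lie_linearl lie_linearr scalerDr addrACA.
Qed.

End Inner.

(** * Second cohomology with trivial coefficients *)

Section H2.
Variables (K : fieldType) (charK : 2%N \in [pchar K]) (n : nat).
Local Notation g := (ogen charK n).
Local Notation form2 := 'Hom(g, 'Hom(g, K^o)).
Local Notation u := (ogen_u charK).
Local Notation d := (ogen_d charK).
Local Notation h p := (u p (star p)).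
Local Notation up := (lshift n).
Local Notation dn := (@rshift n n).
Implicit Types (p q r s t : 'I_(n + n)) (X Y Z : g).

Lemma a_hatE i j X : a_hat charK i j X = scoord X (up i) (dn j).
Proof. by rewrite entryE /scoord star_rshift. Qed.

Lemma b_hatE i j X : b_hat charK i j X = scoord X (up i) (up j).
Proof. by rewrite entryE /scoord star_lshift. Qed.

Lemma c_hatE i j X : c_hat charK i j X = scoord X (dn i) (dn j).
Proof. by rewrite entryE /scoord star_rshift. Qed.

(** The two summands S J T and T J S of a bracket are transposes of each other, so their diagonals
    cancel. Hence diagonal coordinates are 1-cocycles. *)
Lemma scoord_lie_diag X Y p : scoord (lie X Y) p p = 0.
Proof.
rewrite scoord_lie [X in _ + X](reindex_inj (inv_inj (@starK n))) /=.
rewrite -[RHS](addrr_pchar2 charK (\sum_t scoord X p t * scoord Y (star t) p)).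
congr (_ + _); apply: eq_bigr => t _.
by rewrite starK mulrC [scoord Y p _]scoordC [scoord X t p]scoordC.
Qed.

(** The wedge of two diagonal coordinates, its sign dropped in characteristic 2. *)
Definition diag_wedge p q X Y : K :=
  scoord X p p * scoord Y q q + scoord X q q * scoord Y p p.

(* The entry (S J T) p p, half of the vanishing diagonal entry of
   [S J, T J] = (S J T + T J S) J. *)
Definition half_lie p X Y : K :=
  \sum_t scoord X t p * scoord Y (star t) p.

(** Splitting the summation index of [half_lie] into its two halves, the terms at [up i] and [dn i]
    together form the wedge of index i. *)
Lemma sum_a_c j X Y :
  H2_cocycles charK n (inl (inr (inl j))) X Y = half_lie (dn j) X Y.
Proof.
rewrite /= !add_lfunE !sum_lfunE.
have -> : wedge (a_hat charK j j) (c_hat charK j j) X Y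
          + \sum_(i | i != j) wedge (a_hat charK i j) (c_hat charK i j) X Y
          = \sum_i wedge (a_hat charK i j) (c_hat charK i j) X Y.
  by rewrite [RHS](bigD1 j).
rewrite /half_lie big_split_ord /= -big_split; apply: eq_bigr => i _.
rewrite wedgeE !a_hatE !c_hatE star_lshift star_rshift.
by rewrite [in LHS](oppr_pchar2 charK).
Qed.

Lemma sum_a_b j X Y :
  H2_cocycles charK n (inl (inr (inr j))) X Y = half_lie (up j) X Y.
Proof.
rewrite /= !add_lfunE !sum_lfunE.
have -> : wedge (a_hat charK j j) (b_hat charK j j) X Y
          + \sum_(i | i != j) wedge (a_hat charK j i) (b_hat charK i j) X Y
          = \sum_i wedge (a_hat charK j i) (b_hat charK i j) X Y.
  by rewrite [RHS](bigD1 j).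
rewrite /half_lie big_split_ord /= -big_split; apply: eq_bigr => i _.
rewrite wedgeE !a_hatE !b_hatE star_lshift star_rshift.
rewrite [in LHS](oppr_pchar2 charK) addrC.
by rewrite ![scoord _ (up j) (dn i)]scoordC.
Qed.

Lemma H2_cocyclesE k X Y : H2_cocycles charK n k X Y =
  match k with
  | inl (inl (inl e)) => diag_wedge (dn (val e).1) (dn (val e).2) X Y
  | inl (inl (inr e)) => diag_wedge (up (val e).1) (up (val e).2) X Y
  | inl (inr (inl j)) => half_lie (dn j) X Y
  | inl (inr (inr j)) => half_lie (up j) X Y
  | inr e => diag_wedge (up (val e).1) (dn (val e).2) X Y
  end.
Proof.
case: k => [[[e|e]|[j|j]]|e]; rewrite ?sum_a_c ?sum_a_b //=;
  by rewrite wedgeE ?b_hatE ?c_hatE /diag_wedge (oppr_pchar2 charK).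
Qed.

Lemma half_lie_cyclic p X Y Z :
  half_lie p (lie X Y) Z + half_lie p (lie X Z) Y + half_lie p (lie Y Z) X = 0.
Proof.
(* This is the diagonal entry of X J Y J Z, invariant under reversal by transposition. The three
   cocycle terms expand to six such entries, equal in pairs. *)
pose T X Y Z := \sum_t \sum_s
  scoord X (star t) p * scoord Y t s * scoord Z (star s) p.
have TC X1 X2 X3 : T X1 X2 X3 = T X3 X2 X1.
  rewrite /T exchange_big; apply: eq_bigr => s _; apply: eq_bigr => t _.
  by rewrite [scoord X2 t s]scoordC; ring.
have hE X1 X2 X3 : half_lie p (lie X1 X2) X3 = T X3 X1 X2 + T X3 X2 X1.
  rewrite /half_lie /T -big_split; apply: eq_bigr => t _ /=.
  rewrite scoord_lie mulrDl !mulr_suml.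
  by congr (_ + _); apply: eq_bigr => s _; ring.
rewrite !hE (TC Y X Z) (TC Y Z X) (TC X Y Z).
set a := T Z X Y; set b := T Z Y X; set c := T X Z Y.
have -> : a + b + (a + c) + (b + c) = (a + a) + (b + b) + (c + c) by ring.
by rewrite !(addrr_pchar2 charK).
Qed.

(** The terms at t and [star t] coincide and [star] has no fixed point, so the sum cancels in
    pairs. *)
Lemma half_lie_xx p X : half_lie p X X = 0.
Proof.
rewrite /half_lie big_split_ord /= -[RHS](addrr_pchar2 charK
  (\sum_i scoord X (up i) p * scoord X (dn i) p)).
congr (_ + _); apply: eq_bigr => i _; rewrite ?star_lshift ?star_rshift //.
exact: mulrC.
Qed.

Lemma H2_cocycles_cocycle k : cocycle2 (H2_cocycles charK n k).
Proof.
split=> [X|X Y Z].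
  rewrite H2_cocyclesE; case: k => [[[e|e]|[j|j]]|e]; rewrite ?half_lie_xx //;
    by rewrite /diag_wedge [X in _ + X]mulrC (addrr_pchar2 charK).
rewrite /ce_d2 (oppr_pchar2 charK (H2_cocycles charK n k (lie X Y) Z)).
rewrite (oppr_pchar2 charK (H2_cocycles charK n k (lie Y Z) X)).
rewrite !H2_cocyclesE; case: k => [[[e|e]|[j|j]]|e];
  rewrite ?half_lie_cyclic // /diag_wedge !scoord_lie_diag;
  by rewrite !(mul0r, addr0).
Qed.

Lemma diag_wedge_dd p q r s : diag_wedge p q (d r) (d s) =
  ((p == r) && (q == s))%:R + ((q == r) && (p == s))%:R.
Proof. by rewrite /diag_wedge !scoord_d !andbb -!natrM !mulnb. Qed.

Lemma diag_wedge_ul p q r s X : diag_wedge p q (u r s) X = 0.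
Proof.
rewrite /diag_wedge !scoord_u ![(_ == r) && _]andbC.
by rewrite !(addrr_pchar2 charK) !mul0r addr0.
Qed.

Lemma half_lie_dd p r s : half_lie p (d r) (d s) = 0.
Proof.
rewrite /half_lie big1 // => t _; rewrite !scoord_d.
have [->|_] := eqVneq p r; last by rewrite andbF mul0r.
have [->|_] := eqVneq r s; last by rewrite andbF mulr0.
by rewrite !andbT -natrM mulnb; case: eqP => // ->; rewrite starE.
Qed.

Lemma half_lie_hd p q : half_lie p (h q) (d q) = (p == q)%:R.
Proof.
rewrite /half_lie (bigD1 (star q)) //= big1 => [|t tq].
  rewrite scoord_d scoord_u !starE eqxx addr0 add0r /=.
  by rewrite -natrM mulnb andbb.
by rewrite scoord_d eq_starl (negPf tq) mulr0.
Qed.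

Lemma half_lie_uu p r s : apart r s ->
  half_lie p (u r s) (u (star r) (star s)) = 0.
Proof.
move=> rs; rewrite /half_lie big1 // => t _; rewrite !scoord_u !star_eq.
have [->|_] := eqVneq p r.
  by rewrite !(apartF rs, starE) !andbF !addr0 mulr0.
have [->|_] := eqVneq p s.
  by rewrite !(apartF rs, starE) !andbF !addr0 mulr0.
by rewrite !andbF !mulr0n addr0 mul0r.
Qed.

Lemma half_lie_uu0 p i j :
  half_lie p (u (up i) (up j)) (u (dn i) (dn j)) = 0.
Proof.
have [->|ij] := eqVneq i j; last first.
  by rewrite -!star_lshift half_lie_uu // apartE !idx_lshift.
by rewrite ogen_upp /half_lie big1 // => t _; rewrite scoord0 mul0r.
Qed.

(** * Functionals dual to the cocycles, based at the index of the excluded pair *)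

Section Dual.
Variable (i0 : 'I_n).
Hypothesis i0_last : i0 = n.-1 :> nat.

(* In the last family, the correction terms for i = j make the functional
   vanish on the coboundary of the trace of the block A, which is the sum of
   all b_ii^ /\ c_ii^. *)
Definition H2_functional
    (k : (Defs.lt_pair n + Defs.lt_pair n) + ('I_n + 'I_n) + not_last_pair n)
    (f : form2) : K :=
  match k with
  | inl (inl (inl e)) => f (d (dn (val e).1)) (d (dn (val e).2))
  | inl (inl (inr e)) => f (d (up (val e).1)) (d (up (val e).2))
  | inl (inr (inl j)) => f (h (dn j)) (d (dn j))
  | inl (inr (inr j)) => f (h (up j)) (d (up j))
  | inr e => let: (i, j) := val e in
      f (d (up i)) (d (dn j))
      + (f (d (up i0)) (d (dn i0))
         + f (u (up i) (up i0)) (u (dn i) (dn i0))) *+ (i == j)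
  end.

Lemma H2_functional_linear k a (f1 f2 : form2) :
  H2_functional k (a *: f1 + f2) = a * H2_functional k f1 + H2_functional k f2.
Proof.
case: k => [[[e|e]|[j|j]]|[[i j] e]] /=; rewrite !add_lfunE !scale_lfunE //.
rewrite /GRing.scale /=; case: (i == j); rewrite ?mulr0n ?mulr1n; ring.
Qed.

Lemma H2_functional_cocycles k l :
  H2_functional k (H2_cocycles charK n l) = (k == l)%:R.
Proof.
have ltF (e e' : Defs.lt_pair n) :
    ((val e').2 == (val e).1) && ((val e').1 == (val e).2) = false.
  apply/negP=> /andP[/eqP e1 /eqP e2]; have := valP e; have := valP e'.
  by rewrite /= e1 e2 => lt1 lt2; have := ltn_trans lt1 lt2; rewrite ltnn.
case: k => [[[e|e]|[j|j]]|[[i j] e]] /=; rewrite !H2_cocyclesE;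
  case: l => [[[e'|e']|[j'|j']]|[[i' j'] e']] //=;
  rewrite ?diag_wedge_dd ?diag_wedge_ul ?half_lie_dd ?half_lie_hd //=;
  rewrite ?(eq_lshift, eq_rshift, eq_lrshift, eq_rlshift) //=;
  rewrite ?(andbF, addr0, add0r, ltF) //=.
- by rewrite (eq_sym (sval e').1) (eq_sym (sval e').2).
- by rewrite (eq_sym (sval e').1) (eq_sym (sval e').2).
- by rewrite eq_sym.
- by rewrite eq_sym.
- exact: mul0rn.
- exact: mul0rn.
- by rewrite half_lie_uu0 ?mul0rn.
- by rewrite half_lie_uu0 ?mul0rn.
(* The term at [i0] in the functional would detect only the excluded pair. *)
have -> : (i' == i0) && (j' == i0) = false.
  by apply/negP=> /andP[/eqP ei /eqP ej]; rewrite ei ej i0_last eqxx in e'.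
rewrite mul0rn addr0.
by rewrite (eq_sym i') (eq_sym j').
Qed.

(** All brackets involved vanish except in the last family with i = j. There the three brackets are
    h_i, h_i0 and h_i + h_i0 when i and [i0] differ, and they add up to zero. *)
Lemma H2_functional_coboundary k f : coboundary2 f -> H2_functional k f = 0.
Proof.
case=> l fE; have {}fE X Y : f X Y = l (lie X Y).
  by rewrite fE /ce_d1 (oppr_pchar2 charK (l _)).
case: k => [[[e|e]|[j|j]]|[[i j] e]] /=;
  rewrite !fE ?lie_hd ?linear0 // !lie_dd.
- by rewrite star_rshift eq_lrshift mulr0n linear0.
- by rewrite star_lshift eq_rlshift mulr0n linear0.
rewrite !star_lshift eq_rshift eqxx mulr1n.
have [<-|_] := eqVneq i j; last by rewrite linear0 addr0.
rewrite !mulr1n -!star_lshift.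
have [<-|ne] := eqVneq i i0.
  by rewrite !ogen_upp linear0 linear0 addr0 (addrr_pchar2 charK (l _)).
rewrite lie_uu_star; last by rewrite /apart star_lshift eq_lrshift eq_lshift ne.
by rewrite linearD addrA (addrr_pchar2 charK (l _ + l _)).
Qed.

Lemma linear_form_on_u (F : 'I_(n + n) -> 'I_(n + n) -> K) :
  (forall p q, F p q = F q p) ->
  exists l : 'Hom(g, K^o), forall p q, p != q -> l (u p q) = F p q.
Proof.
move=> FC.
(* Increasing pairs list each off-diagonal coordinate of a symmetric matrix once; counting it twice
   would give zero. *)
exists (\sum_(e : 'I_(n + n) * 'I_(n + n) | (e.1 < e.2)%N)
          (F e.1 e.2 *: entry charK e.1 (star e.2))).
suff lu p q : (p < q)%N -> (\sum_(e : 'I_(n + n) * 'I_(n + n) | (e.1 < e.2)%N)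
          (F e.1 e.2 *: entry charK e.1 (star e.2))) (u p q) = F p q.
  move=> p q; rewrite neq_ltn => /orP[/lu//|/lu].
  by rewrite FC ogen_uC.
move=> pq; rewrite sum_lfunE (bigD1 (p, q)) //= big1 => [|e /andP[le ne]].
  rewrite scale_lfunE entryE -[ogen_mx _ _ _]/(scoord _ _ _) scoord_u !eqxx.
  rewrite (ltn_eqF pq : (p == q) = false) addr0 addr0.
  exact: mulr1.
rewrite scale_lfunE entryE -[ogen_mx _ _ _]/(scoord _ _ _) scoord_u.
rewrite -xpair_eqE -surjective_pairing (negPf ne).
case: eqP => [e1|_]; last by rewrite addr0; apply: mulr0.
case: eqP => [e2|_]; last by rewrite addr0; apply: mulr0.
by rewrite e1 e2 in le; have := ltn_trans le pq; rewrite ltnn.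
Qed.

Lemma coboundary_of_H2_functional f :
  cocycle2 f -> (forall k, H2_functional k f = 0) -> coboundary2 f.
Proof.
move=> cf f0; have altf : alternating f by have [] := cf.
have fC X Y := alternatingC X Y altf.
pose p0 := up i0.
pose phi i : K := f (u (up i) p0) (u (star (up i)) (star p0)).
(* The values of the correcting form are forced: on root vectors by [h_p, u_pq] = u_pq, on h_p0 by
   h_p0 = [d_p0, d_(star p0)], and on the other h_p by the bracket h_p + h_p0 of opposite root
   vectors. *)
pose F p q : K := if p == star q then phi (idx p) + f (d p0) (d (star p0)) else
  if p == q then 0 else f (h p) (u p q).
have FC p q : F p q = F q p.
  rewrite /F -eq_starl [star p == q]eq_sym; case: eqVneq => [->|qp].
    by rewrite idx_star.
  rewrite eq_sym; case: eqVneq => // pq.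
  rewrite [u q p]ogen_uC; apply: cocycle2_hu_eq => //.
  by rewrite /apart eq_sym pq -eq_starl eq_sym.
have [l lE] := linear_form_on_u FC.
suff -> : f = lie_form l by apply: coboundary2_lie_form.
have phi_i0 : phi i0 = 0 by rewrite /phi /p0 ogen_upp linear0 zero_lfunE.
have lh p : l (h p) = phi (idx p) + f (d p0) (d (star p0)).
  by rewrite lE ?star_neq // /F starK eqxx.
have fhd p : f (h p) (d p) = 0.
  rewrite -(splitK p); case: (split p) => i /=.
    exact: (f0 (inl (inr (inr i)))).
  exact: (f0 (inl (inr (inl i)))).
(* This is the vanishing of the corrected functional at (i, i). The pair (i0, i0) has no functional,
   but there the identity is trivial because [phi i0 = 0]. *)
have fdd_star i : f (d (up i)) (d (dn i)) = phi i + f (d p0) (d (star p0)).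
  have [->|ne] := eqVneq i i0; first by rewrite phi_i0 add0r star_lshift.
  have ni : ~~ [&& (i, i).1 == n.-1 :> nat & (i, i).2 == n.-1 :> nat].
    by rewrite /= andbb -i0_last.
  have := f0 (inr (exist _ (i, i) ni)) => /=; rewrite eqxx mulr1n.
  move/(pchar2_add_eq0 charK)->; rewrite addrC /phi /p0 !star_lshift //.
have fdd_upup i j : f (d (up i)) (d (up j)) = 0.
  have [lt|lt|/val_inj->] := ltngtP i j; last exact: altf.
    exact: (f0 (inl (inl (inr (exist _ (i, j) lt))))).
  by rewrite fC; apply: (f0 (inl (inl (inr (exist _ (j, i) lt))))).
have fdd_dndn i j : f (d (dn i)) (d (dn j)) = 0.
  have [lt|lt|/val_inj->] := ltngtP i j; last exact: altf.
    exact: (f0 (inl (inl (inl (exist _ (i, j) lt))))).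
  by rewrite fC; apply: (f0 (inl (inl (inl (exist _ (j, i) lt))))).
have fdd_updn i j : i != j -> f (d (up i)) (d (dn j)) = 0.
  move=> ne.
  have ni : ~~ [&& (i, j).1 == n.-1 :> nat & (i, j).2 == n.-1 :> nat].
    apply: contra ne => /= /andP[/eqP ei /eqP ej].
    by apply/eqP/val_inj; rewrite /= ei ej.
  have := f0 (inr (exist _ (i, j) ni)) => /=; rewrite (negPf ne) mulr0n addr0.
  by [].
apply/eqP; rewrite -subr_eq0; apply/eqP.
apply: (@cocycle2_eq0 _ charK n _ _ p0) => [|p q pq|p|p q|i].
- rewrite addrC -scaleN1r; apply: cocycle2_lin cf.
  exact/coboundary2_cocycle/coboundary2_lie_form.
- rewrite add_lfunE opp_lfunE add_lfunE opp_lfunE lie_formE lie_hu //.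
  by rewrite lE /F ?(apartF pq) ?subrr //; case/andP: pq.
- rewrite add_lfunE opp_lfunE add_lfunE opp_lfunE lie_formE lie_hd.
  by rewrite fhd linear0 subrr.
- rewrite add_lfunE opp_lfunE add_lfunE opp_lfunE lie_formE lie_dd.
  have [<-|] := eqVneq (star p) q.
    rewrite mulr1n lh -(splitK p); case: (split p) => i /=.
      by rewrite idx_lshift [star (up i)]star_lshift fdd_star subrr.
    rewrite idx_rshift [star (dn i)]star_rshift fC fdd_star.
    exact: subrr.
  rewrite mulr0n linear0 subr0.
  rewrite -(splitK p) -(splitK q); case: (split p) (split q) => i [] j /=;
    rewrite ?star_lshift ?star_rshift ?eq_lshift ?eq_rshift => ne //.
  - by rewrite fdd_updn.
  by rewrite fC fdd_updn // eq_sym.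
rewrite add_lfunE opp_lfunE add_lfunE opp_lfunE lie_formE.
have [->|ne] := eqVneq i i0.
  rewrite -/(phi i0) phi_i0 ogen_upp lieCg linear0 linear0.
  exact: subrr.
rewrite lie_uu_star; last by rewrite /apart star_lshift eq_lrshift eq_lshift ne.
rewrite linearD /= !lh.
rewrite !idx_lshift phi_i0 add0r -addrA -/(phi i).
by rewrite (addrr_pchar2 charK (f (d p0) _)) addr0 subrr.
Qed.

Theorem ogen_H2_basis : H2_basis (H2_cocycles charK n).
Proof.
apply: (quotient_basis_dual (phi := H2_functional)).
- exact: H2_cocycles_cocycle.
- exact: cocycle2_lin.
- exact: H2_functional_linear.
- exact: H2_functional_cocycles.
- exact: H2_functional_coboundary.
exact: coboundary_of_H2_functional.
Qed.

End Dual.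

End H2.

(** * First cohomology with adjoint coefficients *)

Section H1.
Variables (K : fieldType) (charK : 2%N \in [pchar K]) (n : nat).
Local Notation g := (ogen charK n).
Local Notation u := (ogen_u charK).
Local Notation d := (ogen_d charK).
Local Notation h p := (u p (star p)).
Local Notation up := (lshift n).
Local Notation dn := (@rshift n n).
Local Notation sc := scoord.
Implicit Types (p q r s t : 'I_(n + n)) (X Y Z : g).

Lemma not_apartE p q : (idx p == idx q) = (p == q) || (p == star q).
Proof. by apply: negb_inj; rewrite -apartE negb_or. Qed.

(** The exclusive or is the value at h_p of the weight [r]+[s]: meeting both r and s contributes 1 +
    1 = 0. *)
Lemma scoord_lieh p X r s :
  sc (lie (h p) X) r s = sc X r s *+ ((idx p == idx r) (+) (idx p == idx s)).
Proof.
have red t w : sc X p w *+ (t == p) + sc X (star p) w *+ (t == star p)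
               = sc X t w *+ (idx p == idx t).
  rewrite (eq_sym (idx p)) not_apartE; have [->|_] := eqVneq t p.
    by rewrite starE addr0.
  by have [->|_] := eqVneq t (star p); rewrite add0r.
rewrite scoord_lieu starK red -addrA ![scoord X r _]scoordC.
rewrite [X in _ + X]addrC red.
rewrite [sc X s r]scoordC; case: (_ == _); case: (_ == _) => //=;
  by rewrite ?addr0 ?add0r ?mulr0n // (addrr_pchar2 charK).
Qed.

Lemma lie_hu_weight p a b :
  lie (h p) (u a b) = u a b *+ ((idx p == idx a) (+) (idx p == idx b)).
Proof.
apply: scoord_inj => r s; rewrite scoord_lieh scoordMb scoord_u.
case: eqVneq => [->|_]; case: eqVneq => [->|_]; case: eqVneq => [->|_] //=;
  case: eqVneq => [->|_] //=; rewrite ?mul0rn // ?addr0 ?add0r ?mul0rn //.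
by rewrite addbC.
Qed.

(** * Vanishing of normalized derivations *)

Section Rigid.
Variables (D : 'End(g)) (p0 : 'I_(n + n)) (m : 'I_(n + n) -> 'I_(n + n)).
Hypothesis der : derivation D.
Hypothesis m_apart : forall p, apart p (m p).
Hypothesis apart2 : forall p q, exists2 r, apart p r & apart q r.

Lemma scoord_der X Y r s : sc (D (lie X Y)) r s =
  sc (lie Y (D X)) r s + sc (lie X (D Y)) r s.
Proof. by rewrite der scoordD [lie Y _]lieCg. Qed.

(** Of these normalizations, [D_hu], [D_dh] and [D_up0] will be reached by subtracting an inner
    derivation, while [D_dm] and [D_p0] express the vanishing of the dual functionals. *)
Hypothesis D_hu : forall r s, apart r s -> sc (D (h r)) r s = 0.
Hypothesis D_dm : forall p, sc (D (d p)) (m p) (star (m p)) = 0.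
Hypothesis D_dh : forall p, sc (D (d p)) p (star p) = 0.
Hypothesis D_p0 : sc (D (d p0)) p0 p0 = 0.
Hypothesis D_up0 : forall i, sc (D (u (up i) p0)) (up i) p0 = 0.

Let D0 : D 0 = 0. Proof. exact: linear0. Qed.

Let lie0 X : lie X 0 = 0. Proof. exact: linear0. Qed.

Let simp := (mulr0n, mulr1n, addr0, add0r, starE, eqxx).

Let Dh_u p r s : apart r s -> sc (D (h p)) r s = 0.
Proof.
move=> rs; have [pr|/h_not_apart->] := boolP (apart p r); last exact: D_hu.
have [ps|/h_not_apart->] := boolP (apart p s); last first.
  by rewrite scoordC D_hu // apartC.
have := scoord_der (h p) (h r) r s.
rewrite lie_hh D0 scoord0 !scoord_lieh eqxx; rewrite !apartE in rs pr ps.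
by rewrite (negPf rs) (negPf pr) (negPf ps) !simp.
Qed.

Let Du_off a b r s : apart a b -> apart a r -> apart a s ->
  sc (D (u a b)) r s = 0.
Proof.
move=> ab ar aS; have := scoord_der (h a) (u a b) r s.
rewrite lie_hu // scoord_lieu scoord_lieh.
rewrite !(apartF ar, apartF aS, starE) !simp => ->.
rewrite !apartE in ar aS *; rewrite (negPf ar) (negPf aS) /= addr0.
by case: eqP => _; case: eqP => _; rewrite ?simp ?Dh_u ?simp ?Dh_u //
  ?apart_starl ?apart_starr ?apartE // eq_sym.
Qed.

(** At coordinates of the weight of u_ab, h_c scales u_ab and its image under [D] by the same
    factor, so these terms cancel in the Leibniz rule. *)
Let Dh_comm c a b r s : idx r = idx a -> idx s = idx b ->
  sc (lie (u a b) (D (h c))) r s = 0.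
Proof.
move=> ra sb; have := scoord_der (h c) (u a b) r s.
rewrite lie_hu_weight scoord_lieh ra sb; case: (_ (+) _) => /=.
  by rewrite !mulr1n -[X in X = _]add0r => /addIr.
by rewrite !mulr0n D0 scoord0 addr0.
Qed.

Let Dh_diag c a : sc (D (h c)) a a = 0.
Proof.
have [b ab _] := apart2 a a.
have := @Dh_comm c (star a) b a b (esym (idx_star a)) erefl.
by rewrite scoord_lieu !(apartF ab, starE) !simp.
Qed.

Let Dh_star_eq c a b : apart a b ->
  sc (D (h c)) a (star a) = sc (D (h c)) b (star b).
Proof.
move=> ab; have := @Dh_comm c a b a b erefl erefl.
rewrite scoord_lieu !(apartF ab, starE) !simp => /(pchar2_add_eq0 charK) <-.
exact: scoordC.
Qed.

(** Writing h_p = [d_p, d_(star p)] gives zero off the orbit of p; [Dh_star_eq] carries this to the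
    orbit of p from a third orbit. *)
Let Dh_star p b : sc (D (h p)) b (star b) = 0.
Proof.
have Dh0 c : apart p c -> sc (D (h p)) c (star c) = 0.
  move=> pc; have := scoord_der (d p) (d (star p)) c (star c).
  rewrite lie_dd_star => ->.
  by rewrite !scoord_lied !(apartF pc, starE) !simp.
have [pb|] := boolP (apart p b); first exact: Dh0.
have [c pc bc] := apart2 p b.
by rewrite (Dh_star_eq p bc) Dh0.
Qed.

Let Dh p : D (h p) = 0.
Proof.
apply: scoord_inj => r s; rewrite scoord0.
have [rs|/not_apart] := boolP (apart r s); first exact: Dh_u.
by case=> ->; rewrite ?Dh_diag // scoordC Dh_star.
Qed.

Let Dd_off p r s : apart r s -> sc (D (d p)) r s = 0.
Proof.
move=> rs; have := scoord_der (h r) (d p) r s.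
rewrite lie_hd D0 scoord0 Dh lie0 scoord0 add0r scoord_lieh eqxx.
by rewrite apartE in rs; rewrite (negPf rs).
Qed.

Let Dd_star p : sc (D (d p)) (star p) (star p) = 0.
Proof.
have [q pq _] := apart2 p p.
have := scoord_der (d p) (u p q) (star p) q.
rewrite lie_du !(apartF pq, starE) !simp D0 scoord0.
by rewrite scoord_lieu scoord_lied !(apartF pq, starE) !simp => <-.
Qed.

Let Dd_diag p q : p != q -> sc (D (d p)) q q = 0.
Proof.
move=> ne; have [->|nes] := eqVneq q (star p); first exact: Dd_star.
have pq : apart p q by rewrite /apart ne -eq_starl eq_sym nes.
have := scoord_der (d p) (d (star q)) (star q) q.
rewrite lie_dd !(apartF pq, starE) !simp D0 scoord0.
by rewrite !scoord_lied !(apartF pq, starE) !simp => <-.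
Qed.

(** Since d_p commutes with u_rs off its orbit, this coordinate is constant over the orbits apart
    from p. The constant is the contribution of the tensors with the identity, and [D_dm] sets it to
    zero. *)
Let Dd_dh p q : sc (D (d p)) q (star q) = 0.
Proof.
have eq_st r s : apart p r -> apart p s -> apart r s ->
    sc (D (d p)) r (star r) = sc (D (d p)) s (star s).
  move=> pr ps rs; have := scoord_der (d p) (u r s) r s.
  rewrite lie_du !(apartF pr, apartF ps, starE) !simp D0 scoord0.
  rewrite scoord_lieu scoord_lied.
  rewrite !(apartF pr, apartF ps, apartF rs, starE) !simp.
  by move/esym/(pchar2_add_eq0 charK)<-; rewrite scoordC.
have [pq|] := boolP (apart p q); last first.
  rewrite apartC => /not_apart[] ->; first exact: D_dh.
  by rewrite starK scoordC D_dh.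
have [mq|] := boolP (apart (m p) q).
  by rewrite -(eq_st _ _ (m_apart p) pq mq) D_dm.
rewrite apartC => /not_apart[] ->; first exact: D_dm.
by rewrite starK scoordC D_dm.
Qed.

(** [al] and [M] are the diagonal entries of [D] at d_p and u_pq. They add up along brackets, as the
    degrees of a grading do. *)
Let al p := sc (D (d p)) p p.
Let M p q := sc (D (u p q)) p q.

Let MC p q : M p q = M q p.
Proof. by rewrite /M ogen_uC scoordC. Qed.

Let M_starl p q : apart p q -> M p q = al p + M (star p) q.
Proof.
move=> pq; have := scoord_der (d p) (u (star p) q) p q.
rewrite lie_du1 // -/(M p q) => ->.
by rewrite scoord_lieu scoord_lied !(apartF pq, starE) !simp.
Qed.

Let Du_starl p q : apart p q -> sc (D (u p q)) (star p) q = 0.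
Proof.
move=> pq; have := scoord_der (d p) (u (star p) q) (star p) q.
rewrite lie_du1 // => ->.
rewrite scoord_lieu scoord_lied !(apartF pq, starE) !simp.
by rewrite ![sc _ (star _) _]scoordC !Dd_dh addr0.
Qed.

Let Du_starlr p q : apart p q -> sc (D (u p q)) (star p) (star q) = 0.
Proof.
move=> pq; have := scoord_der (d p) (u (star p) q) (star p) (star q).
rewrite lie_du1 // => ->.
rewrite scoord_lieu scoord_lied !(apartF pq, starE) !simp.
by apply: Dd_diag; rewrite -eq_starl eq_sym (apartF pq).
Qed.

Let M_trans p q r : apart p q -> apart p r -> apart q r ->
  M p r = M p q + M (star q) r.
Proof.
move=> pq pr qr; have := scoord_der (u p q) (u (star q) r) p r.
rewrite lie_uu1 // -/(M p r) => ->.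
by rewrite !scoord_lieu !(apartF pq, apartF pr, apartF qr, starE) !simp.
Qed.

Let M_star p q : apart p q -> M (star p) (star q) = M p q.
Proof.
move=> pq; have := scoord_der (u p q) (u (star p) (star q)) p (star p).
rewrite lie_uu_star // linearD /= !Dh addr0 scoord0.
rewrite !scoord_lieu !(apartF pq, starE) !simp.
move/esym/(pchar2_add_eq0 charK); rewrite /M => ->.
exact: scoordC.
Qed.

(** Applying [M_starl] at both indices and comparing with [M_star] shows that [al] is constant. This
    scalar is 1 for [ad_D], and [D_p0] makes it 0. *)
Let al0 p : al p = 0.
Proof.
have al_eq q r : apart q r -> al q = al r.
  move=> qr; have rqs : apart r (star q) by rewrite apart_starr apartC.
  have := M_starl qr; rewrite [M (star q) r]MC (M_starl rqs).
  rewrite [M (star r) _]MC M_star // addrA -[X in X = _]add0r.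
  by move/addIr/esym/(pchar2_add_eq0 charK).
have [r pr p0r] := apart2 p p0.
by rewrite (al_eq _ _ pr) -(al_eq _ _ p0r); apply: D_p0.
Qed.

(** With [al] zero, [M] depends only on orbits, and [M_trans] through [p0] reduces it to [D_up0]. *)
Let M_eq0 p q : apart p q -> M p q = 0.
Proof.
have Mp0 r : apart r p0 -> M r p0 = 0.
  rewrite -(splitK r); case: (split r) => i /= rp; first exact: D_up0.
  by rewrite M_starl // al0 star_rshift add0r; apply: D_up0.
have Mp0l r s : apart r s -> ~~ apart r p0 -> M r s = 0.
  move=> rs /not_apart[] def_r; rewrite def_r ?apart_starl in rs *.
    by rewrite MC Mp0 // apartC.
  by rewrite M_starl ?apart_starl // al0 add0r starK MC Mp0 // apartC.
move=> pq; have [pp0|] := boolP (apart p p0); last exact: Mp0l.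
have [qp0|] := boolP (apart q p0); last first.
  by rewrite MC; apply: Mp0l; rewrite apartC.
rewrite (M_trans pp0 pq) 1?apartC // Mp0 // add0r.
rewrite MC; have := M_starl (p := star p0) (q := q).
rewrite apart_starl apartC => /(_ qp0).
by rewrite starK al0 add0r MC => ->; rewrite MC Mp0.
Qed.

Lemma derivation_eq0 : D = 0.
Proof.
have Du0 p q r s : apart p q -> idx r = idx p -> idx s = idx q ->
    sc (D (u p q)) r s = 0.
  move=> pq rp sq; have qp : apart q p by rewrite apartC.
  have : ~~ apart r p by rewrite apartE rp eqxx.
  have : ~~ apart s q by rewrite apartE sq eqxx.
  case/not_apart=> ->; case/not_apart=> ->.
  - exact: M_eq0.
  - exact: Du_starl.
  - by rewrite ogen_uC scoordC; apply: Du_starl.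
  exact: Du_starlr.
apply: eq_lfun_ud => [p q pq|p|p]; rewrite zero_lfunE; last first.
- apply: scoord_inj => r s; rewrite scoord0.
  have [rs|/not_apart] := boolP (apart r s); first exact: Dd_off.
  case=> ->; last by rewrite scoordC Dd_dh.
  by have [<-|] := eqVneq p s; [exact: al0 | exact: Dd_diag].
- exact: Dh.
have qp : apart q p by rewrite apartC.
apply: scoord_inj => r s; rewrite scoord0.
have [pr|npr] := boolP (apart p r).
  have [ps|nps] := boolP (apart p s); first exact: Du_off.
  have [qr|nqr] := boolP (apart q r).
    have qs : apart q s by move: nps qp; rewrite !apartE negbK => /eqP->.
    by rewrite ogen_uC Du_off.
  move: nps nqr; rewrite !apartE !negbK => /eqP ps /eqP qr.
  by rewrite scoordC Du0.
have [qs|nqs] := boolP (apart q s).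
  have qr : apart q r by move: npr qp; rewrite !apartE negbK => /eqP->.
  by rewrite ogen_uC Du_off.
move: npr nqs; rewrite !apartE !negbK => /eqP pr /eqP qs.
by rewrite Du0.
Qed.

End Rigid.

(** * The given derivations and their dual functionals *)

Lemma scoord_one p q : sc (ogen_one charK n) p q = (p == star q)%:R.
Proof. by rewrite /sc /ogen_mx /= mxE. Qed.

Lemma lie_one X : lie (ogen_one charK n) X = 0.
Proof.
apply: ogen_mx_inj; rewrite ogen_mx_lie mul1mx mulmx1.
by rewrite -(raddfD (@ogen_mx _ charK n)) addgg.
Qed.

Lemma ad_D_d p : ad_D charK n (d p) = d p.
Proof.
apply: ogen_mx_inj; rewrite ad_DE /mxcomm (opp_mx2 charK) /D_mx.
pose simp := (mul0mx, mulmx0, mul1mx, mulmx1, addr0, add0r).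
rewrite -(splitK p); case: (split p) => i; rewrite /ogen_mx /=.
  have -> : delta_mx (up i) (star (up i)) =
      block_mx 0 (delta_mx i i) 0 0 :> 'M[K]__.
    by rewrite star_lshift /block_mx delta_mx_ushift delta_mx_rshift row_mx0.
  by rewrite !mulmx_block add_block_mx !simp.
have -> : delta_mx (dn i) (star (dn i)) =
    block_mx 0 0 (delta_mx i i) 0 :> 'M[K]__.
  by rewrite star_rshift /block_mx delta_mx_dshift delta_mx_lshift row_mx0.
by rewrite !mulmx_block add_block_mx !simp.
Qed.

(** The identity is central and diagonal coordinates vanish on brackets, so both sides of the
    Leibniz rule are zero. *)
Lemma derivation_tensor_one p :
  derivation (tensor (ogen_one charK n) (entry charK p (star p))).
Proof.
move=> X Y; rewrite !tensorE !entryE.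
have -> : ogen_mx (lie X Y) p (star p) = 0 by apply: scoord_lie_diag.
rewrite (lieCg X) -!adE scale0r.
have one0 a Z : ad (a *: ogen_one charK n) Z = 0.
  by rewrite adE lieCg linearZ /= lieCg lie_one scaler0.
by rewrite !one0 addr0.
Qed.

Lemma derivation_ad_D : derivation (ad_D charK n).
Proof.
move=> X Y; apply: ogen_mx_inj; rewrite (raddfD (@ogen_mx _ charK n)) ad_DE.
rewrite -[RHS]/(mxcomm (ogen_mx _) (ogen_mx Y)
                + mxcomm (ogen_mx X) (ogen_mx _)).
rewrite !ad_DE -[ogen_mx (lie X Y)]/(mxcomm (ogen_mx X) (ogen_mx Y)).
have := mxcomm_jacobi (D_mx K n) (ogen_mx X) (ogen_mx Y).
rewrite [mxcomm (ogen_mx Y) (D_mx K n)]mxcommC (opp_mx2 charK) addrC => /eqP.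
rewrite addr_eq0 (opp_mx2 charK) => /eqP eJ.
rewrite [X in _ = X + _]mxcommC (opp_mx2 charK) eJ -addrA.
by rewrite -[X in _ + (_ + X)](opp_mx2 charK) subrr addr0.
Qed.

Section Dual.
Variables (i0 : 'I_n) (m : 'I_(n + n) -> 'I_(n + n)).
Hypothesis m_apart : forall p, apart p (m p).

Definition H1_functional (k : unit + ('I_n + 'I_n)) (f : 'End(g)) : K :=
  let test p := sc (f (d p)) (m p) (star (m p)) in
  match k with
  | inl _ => sc (f (d (up i0))) (up i0) (up i0)
  | inr (inl j) => test (dn j)
  | inr (inr j) => test (up j)
  end.

Lemma H1_functional_linear k a (f1 f2 : 'End(g)) :
  H1_functional k (a *: f1 + f2) = a * H1_functional k f1 + H1_functional k f2.
Proof.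
by case: k => [?|[j|j]] /=; rewrite add_lfunE scale_lfunE scoordD scoordZ.
Qed.

(** A bracket [x, d_p] is supported on row and column p, which [m p] avoids, and its entry at (p, p)
    is a sum of two equal terms. *)
Lemma H1_functional_inner k f : inner f -> H1_functional k f = 0.
Proof.
case=> x fE; case: k => [?|[j|j]] /=; rewrite fE lieCg scoord_lied.
- by rewrite eqxx scoordC (addrr_pchar2 charK).
- by rewrite !(apartF (m_apart _)) addr0.
- by rewrite !(apartF (m_apart _)) addr0.
Qed.

Lemma H1_functional_derivations k l :
  H1_functional k (H1_derivations charK n l) = (k == l)%:R.
Proof.
case: k => [[]|[j|j]] /=; case: l => [[]|[j'|j']] /=;
  rewrite ?ad_D_d ?tensorE ?scoordZ ?scoord_one ?scoord_d ?eqxx ?starE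
    ?(apartF (m_apart _)) ?mulr0 //.
all: rewrite ?c_hatE ?b_hatE ?scoord_d.
all: rewrite ?(eq_lshift, eq_rshift, eq_lrshift, eq_rlshift).
all: by rewrite eqxx ?mul0r // mulr1 andbb eq_sym.
Qed.

Lemma inner_of_H1_functional f :
  (forall p q, exists2 r, apart p r & apart q r) ->
  derivation f -> (forall k, H1_functional k f = 0) -> inner f.
Proof.
move=> apart2 der f0; pose p0 := up i0.
pose mu i := sc (f (u (up i) p0)) (up i) p0.
(* The coordinates of x are read off from [f]: those at (r, s) from h_r, the diagonal ones from
   d_(star r), and those at (r, star r) from the root vectors joining [up i] to [p0], with value 0
   at [p0]. *)
pose F r s : K := if r == star s then mu (idx r) else
  if r == s then sc (f (d (star r))) (star r) r else sc (f (h r)) r s.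
(* For r and s apart, symmetry is the Leibniz rule on [h_r, h_s] = 0. *)
have FC r s : F r s = F s r.
  rewrite /F -eq_starl [star r == s]eq_sym; case: eqVneq => [->|sr].
    by rewrite idx_star.
  rewrite eq_sym; have [->//|sr'] := eqVneq s r.
  have rs : apart r s by rewrite apartC /apart sr' sr.
  have := scoord_der der (h r) (h s) r s; rewrite lie_hh linear0 scoord0.
  rewrite !scoord_lieh !eqxx; move: rs; rewrite apartE => /negPf rs.
  rewrite rs eq_sym rs /= !mulr1n => /esym/(pchar2_add_eq0 charK)->.
  exact: scoordC.
have [x xE] := scoord_surj charK FC.
have F_star r : F r (star r) = mu (idx r) by rewrite /F starK eqxx.
have mu0 : mu i0 = 0 by rewrite /mu ogen_upp linear0 scoord0.
exists x => y; rewrite -adE; congr (fun_of_lfun _ y).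
apply/eqP; rewrite -subr_eq0; apply/eqP.
have fdm p : sc (f (d p)) (m p) (star (m p)) = 0.
  rewrite -(splitK p); case: (split p) => i /=.
    exact: (f0 (inr (inr i))).
  exact: (f0 (inr (inl i))).
apply: (@derivation_eq0 _ p0 m) => // [|r s rs|p|p||i].
- rewrite addrC -scaleN1r; apply: derivation_lin der.
  by apply: inner_derivation; exists x => z; rewrite adE.
all: rewrite add_lfunE opp_lfunE adE scoordD scoordN lieCg.
- rewrite scoord_lieh eqxx; have := rs; rewrite apartE => /negPf->.
  by rewrite xE /F !(apartF rs) mulr1n (addrr_pchar2 charK).
- by rewrite fdm scoord_lied !(apartF (m_apart p)) !addr0.
- rewrite scoord_lied xE starE eqxx addr0 /F starK star_neqr eqxx.
  by rewrite (addrr_pchar2 charK).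
- rewrite scoord_lied eqxx scoordC (addrr_pchar2 charK) addr0.
  exact: (f0 (inl tt)).
have [->|ne] := eqVneq i i0.
  by rewrite ogen_upp lieCg !linear0 scoord0 addr0.
rewrite scoord_lieu !eq_lshift [i0 == i]eq_sym (negPf ne) !eqxx !addr0.
rewrite !xE (FC (star p0)) !F_star /p0 !idx_lshift mu0 add0r.
exact: (addrr_pchar2 charK).
Qed.

Theorem ogen_H1_basis :
  (forall p q, exists2 r, apart p r & apart q r) ->
  H1_adjoint_basis (H1_derivations charK n).
Proof.
move=> apart2; apply: (quotient_basis_dual (phi := H1_functional)).
- case=> [?|[j|j]] /=; first exact: derivation_ad_D.
    by rewrite /c_hat -star_rshift; apply: derivation_tensor_one.
  by rewrite /b_hat -star_lshift; apply: derivation_tensor_one.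
- exact: derivation_lin.
- exact: H1_functional_linear.
- exact: H1_functional_derivations.
- exact: H1_functional_inner.
by move=> f; apply: inner_of_H1_functional.
Qed.

End Dual.
End H1.

Theorem lemma7p2 (K : closedFieldType) (charK : 2%N \in [pchar K])
    (n : nat) (n_gt0 : (0 < n)%N) :
  H2_basis (H2_cocycles charK n) /\
  ((2 < n)%N -> H1_adjoint_basis (H1_derivations charK n)).
Proof.
split=> [|n_gt2].
  have last_lt : (n.-1 < n)%N by rewrite prednK.
  exact: (@ogen_H2_basis _ charK n (Ordinal last_lt)).
(* The orbits of [star] correspond to the n indices, so n > 2 leaves one outside those of p and
   q. *)
have apart2 (p q : 'I_(n + n)) : exists2 r, apart p r & apart q r.
  have : (0 < #|~: [set idx p; idx q]|)%N.
    rewrite cardsCs setCK card_ord subn_gt0; apply: leq_ltn_trans n_gt2.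
    by rewrite cards2; case: (_ != _).
  case/card_gt0P=> i; rewrite !inE negb_or => /andP[ip iq].
  by exists (lshift n i); rewrite apartE idx_lshift eq_sym.
have /fin_all_exists[m m_apart] (p : 'I_(n + n)) : exists q, apart p q.
  by have [r pr _] := apart2 p p; exists r.
exact: (ogen_H1_basis charK (Ordinal n_gt0) m_apart apart2).
Qed.
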